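(* Let $(R,\mathfrak m)$ be a one-dimensional Noetherian Cohen-Macaulay local ring with infinite residue field $k=R/\mathfrak m\subseteq R$. Let $I$ be a proper regular ideal of $R$, and let $x\in I$ be a minimal (principal) reduction of $I$. Let $U=k+I\subseteq R$, which is a local ring with maximal ideal $\mathfrak n=I$, and let $J=xR$, which is an ideal of $U$. Then $h(I)=1$ if and only if $\mathrm{gr}_{\mathfrak n}(J)$ is a Cohen-Macaulay $\mathrm{gr}_{\mathfrak n}(U)$-module.
   Context: ''$k=R/\mathfrak m\subseteq R$'' means that $R$ contains a field $k$ mapped isomorphically onto the residue field $R/\mathfrak m$. An ideal is regular if it contains a non-zero-divisor. A principal reduction of $I$ is an element $x\in I$ (or the ideal $xR$) with $I^{n+1}=xI^n$ for some $n\ge 0$; in this setting minimal reductions of regular ideals are principal, and such an $x$ is a non-zero-divisor. The subring $U=k+I$ of $R$ is a one-dimensional Noetherian Cohen-Macaulay local ring with maximal ideal $\mathfrak n=I$. The associated graded objects are $\mathrm{gr}_{\mathfrak n}(U)=\bigoplus_{i\ge0}\mathfrak n^i/\mathfrak n^{i+1}$ (with $\mathfrak n^0=U$) and $\mathrm{gr}_{\mathfrak n}(J)=\bigoplus_{i\ge 0}\mathfrak n^iJ/\mathfrak n^{i+1}J$. For a regular ideal $L$ of $R$, the Ratliff-Rush closure is $\widetilde L=\bigcup_{n\ge1}(L^{n+1}:_R L^n)$. The asymptotic Ratliff-Rush number of $I$ is $h(I)=\min\{n\in\mathbb N_+ \mid I^m=\widetilde{I^m}\ \text{for all } m\ge n\}$,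 where $\mathbb N_+$ is the set of positive integers. *)

(* Defs.v *)
From HB Require Import structures.
From mathcomp Require Import all_boot all_order all_algebra.
From mathcomp Require Import ring.
From mathcomp Require Import boolp classical_sets cardinality.

Set Implicit Arguments.
Unset Strict Implicit.
Unset Printing Implicit Defensive.

Import GRing.Theory.
Local Open Scope ring_scope.
Local Open Scope quotient_scope.

(* The ideals of ring_quotient are proper by definition; here the unit ideal is
   needed, and membership is a proposition. *)
Section Ideals.
Variable A : comPzRingType.

Definition is_ideal (S : A -> Prop) : Prop :=
  [/\ S 0, forall a b, S a -> S b -> S (a + b) & forall c a, S a -> S (c * a)].

Record ideal := Ideal { ideal_set :> A -> Prop; idealP : is_ideal ideal_set }.

Lemma ideal0 (I : ideal) : I 0. Proof. by case: (idealP I). Qed.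

Lemma idealD (I : ideal) a b : I a -> I b -> I (a + b).
Proof. by case: (idealP I) => _ h _; apply: h. Qed.

Lemma idealMl (I : ideal) c a : I a -> I (c * a).
Proof. by case: (idealP I) => _ _; apply. Qed.

Lemma idealN (I : ideal) a : I a -> I (- a).
Proof. by rewrite -mulN1r; apply: idealMl. Qed.

Lemma idealB (I : ideal) a b : I a -> I b -> I (a - b).
Proof. by move=> Ia Ib; apply: idealD => //; apply: idealN. Qed.

Lemma ideal_sum (T : Type) (I : ideal) (s : seq T) (P : pred T) (F : T -> A) :
  (forall i, P i -> I (F i)) -> I (\sum_(i <- s | P i) F i).
Proof. by move=> h; elim/big_ind: _ => //; [apply: ideal0 | apply: idealD]. Qed.

Lemma unit_ideal_subproof : is_ideal (fun=> True). Proof. by []. Qed.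
Definition unit_ideal : ideal := Ideal unit_ideal_subproof.

Lemma principal_subproof x : is_ideal (fun a => exists r, a = x * r).
Proof.
split=> [|_ _ [r ->] [s ->]|c _ [r ->]]; first by exists 0; rewrite mulr0.
  by exists (r + s); rewrite mulrDr.
by exists (c * r); rewrite mulrCA.
Qed.
Definition principal_ideal x : ideal := Ideal (principal_subproof x).

Lemma ideal_mul_subproof (I J : ideal) :
  is_ideal (fun a => exists2 s : seq (A * A),
    forall p, p \in s -> I p.1 /\ J p.2 & a = \sum_(p <- s) p.1 * p.2).
Proof.
split=> [|_ _ [s hs ->] [t ht ->]|c _ [s hs ->]].
- by exists [::]; rewrite ?big_nil.
- exists (s ++ t); last by rewrite big_cat.
  by move=> p; rewrite mem_cat => /orP[/hs|/ht].
- exists [seq (c * p.1, p.2) | p <- s].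
    by move=> _ /mapP[p /hs[Ip Jp] ->]; split=> //; apply: idealMl.
  by rewrite big_map mulr_sumr; apply: eq_bigr => p _ /=; rewrite mulrA.
Qed.
Definition ideal_mul (I J : ideal) : ideal := Ideal (ideal_mul_subproof I J).

(* pow_mul I i J = I^i J *)
Definition pow_mul (I : ideal) (i : nat) (J : ideal) : ideal :=
  iter i (ideal_mul I) J.

Definition ideal_pow (I : ideal) (i : nat) : ideal := pow_mul I i unit_ideal.

Lemma pow_mulM (I J : ideal) i j k a b : (i + j)%N = k ->
  ideal_pow I i a -> pow_mul I j J b -> pow_mul I k J (a * b).
Proof.
move=> <-; elim: i a => [|i IH] a /=; first by move=> _; apply: idealMl.
case=> s hs -> hb; exists [seq (p.1, p.2 * b) | p <- s].
  by move=> _ /mapP[p /hs[h1 h2] ->]; split=> //; apply: IH.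
by rewrite big_map mulr_suml; apply: eq_bigr => p _ /=; rewrite mulrA.
Qed.

Definition is_prime (P : ideal) : Prop :=
  ~ P 1 /\ forall a b, P (a * b) -> P a \/ P b.

Record prime_ideal := PrimeIdeal
  { prime_carrier :> ideal; primeP : is_prime prime_carrier }.

Definition is_maximal (m : ideal) : Prop :=
  ~ m 1 /\
  forall J : ideal, (forall a, m a -> J a) -> ~ J 1 -> forall a, J a -> m a.

Definition is_local (m : ideal) : Prop :=
  is_maximal m /\ forall m' : ideal, is_maximal m' -> forall a, m' a <-> m a.

Definition noetherian : Prop :=
  forall I : ideal, exists s : seq A, forall a,
    I a <-> exists c : nat -> A, a = \sum_(i < size s) c i * s`_i.

Definition regular_ideal (I : ideal) : Prop := exists2 a, I a & GRing.lreg a.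

Definition principal_reduction (x : A) (I : ideal) : Prop :=
  I x /\ exists n : nat, forall a,
    ideal_pow I n.+1 a <-> exists2 b, ideal_pow I n b & a = x * b.

Definition ratliff_rush (L : ideal) (a : A) : Prop :=
  exists2 n : nat, (0 < n)%N &
    forall b, ideal_pow L n b -> ideal_pow L n.+1 (a * b).

Definition rr_closed_from (I : ideal) (n : nat) : Prop :=
  (0 < n)%N /\ forall m : nat, (n <= m)%N ->
    forall a, ideal_pow I m a <-> ratliff_rush (ideal_pow I m) a.

(* The least n such that rr_closed_from I n, and 0 if there is none. *)
Definition asymptotic_rr_number (I : ideal) : nat :=
  xget 0%N [set n | rr_closed_from I n /\
                    forall n', rr_closed_from I n' -> (n <= n')%N].

End Ideals.

Lemma ideal_comap_subproof (A B : comPzRingType) (f : {rmorphism A -> B})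
  (I : ideal B) : is_ideal (fun a => I (f a)).
Proof.
split=> [|a b Ia Ib|c a Ia]; rewrite ?rmorph0 ?rmorphD ?rmorphM.
- exact: ideal0.
- exact: idealD.
- exact: idealMl.
Qed.
Definition ideal_comap (A B : comPzRingType) (f : {rmorphism A -> B})
  (I : ideal B) : ideal A := Ideal (ideal_comap_subproof f I).

Section DimensionDepth.
Variables (A : comPzRingType) (M : lmodType A).

Definition annihilates (a : A) : Prop := forall v : M, a *: v = 0.

(* A strictly increasing chain P_0 < ... < P_d of primes containing Ann M. *)
Definition prime_chain (P : nat -> ideal A) (d : nat) : Prop :=
  [/\ forall i, (i <= d)%N -> is_prime (P i),
      forall a, annihilates a -> P 0%N a &
      forall i, (i < d)%N ->
        (forall a, P i a -> P i.+1 a) /\ exists2 a, P i.+1 a & ~ P i a].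

Definition has_dim (d : nat) : Prop :=
  (exists P, prime_chain P d) /\ forall P e, prime_chain P e -> (e <= d)%N.

(* The submodule (s_0, ..., s_{j-1}) M. *)
Definition seq_span (s : seq A) (j : nat) (v : M) : Prop :=
  exists w : nat -> M, v = \sum_(i < j) s`_i *: w i.

Definition regular_seq (s : seq A) : Prop :=
  (forall j, (j < size s)%N ->
     forall v, seq_span s j (s`_j *: v) -> seq_span s j v) /\
  exists v, ~ seq_span s (size s) v.

(* For m the maximal ideal of a local ring. *)
Definition has_depth (m : A -> Prop) (d : nat) : Prop :=
  (exists2 s : seq A, size s = d & regular_seq s /\ forall a, a \in s -> m a) /\
  forall s : seq A, regular_seq s -> (forall a, a \in s -> m a) ->
    (size s <= d)%N.

(* Nonzero Cohen-Macaulay modules over a local ring with maximal ideal m. *)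
Definition cm_local (m : A -> Prop) : Prop :=
  exists2 d, has_depth m d & has_dim d.

End DimensionDepth.

Section Localization.
Variables (A : comPzRingType) (P : prime_ideal A).

Definition loc_den : Type := {s : A | `[< ~ P s >]}.
HB.instance Definition _ := Choice.on loc_den.
Definition den (s : loc_den) : A := sval s.

Lemma denP (s : loc_den) : ~ P (den s).
Proof. by apply/asboolP; case: s. Qed.

Lemma den1_subproof : `[< ~ P 1 >].
Proof. by apply/asboolP; case: (primeP P). Qed.
Definition den1 : loc_den := exist _ 1 den1_subproof.

Lemma denM_subproof (s t : loc_den) : `[< ~ P (den s * den t) >].
Proof.
apply/asboolP; case: (primeP P) => _ h /h[|]; exact: denP.
Qed.
Definition denM (s t : loc_den) : loc_den := exist _ (den s * den t) (denM_subproof s t).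

Lemma den1E : den den1 = 1. Proof. by []. Qed.
Lemma denME s t : den (denM s t) = den s * den t. Proof. by []. Qed.

Section Module.
Variable M : lmodType A.

Definition loc_equiv (x y : M * loc_den) : bool :=
  `[< exists u : loc_den, (den u * den y.2) *: x.1 = (den u * den x.2) *: y.1 >].

Lemma loc_equiv_is_equiv : equiv_class_of loc_equiv.
Proof.
split=> [x|x y|y x z]; first by apply/asboolP; exists den1.
  by apply/asboolP/asboolP => -[u h]; exists u; rewrite h.
move=> /asboolP[u hu] /asboolP[w hw]; apply/asboolP.
exists (denM y.2 (denM u w)); rewrite !denME.
have -> : den y.2 * (den u * den w) * den z.2 =
        den w * den z.2 * (den u * den y.2) :> A by ring.
rewrite -scalerA hu scalerA.
have -> : den w * den z.2 * (den u * den x.2) =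
        den u * den x.2 * (den w * den z.2) :> A by ring.
by rewrite -scalerA hw scalerA; congr (_ *: _); ring.
Qed.

Canonical loc_equiv_equiv := EquivRelPack loc_equiv_is_equiv.
Canonical loc_equiv_encModRel := defaultEncModRel loc_equiv.

(* M_P *)
Definition loc_module : Type := {eq_quot loc_equiv}.
HB.instance Definition _ := Choice.on loc_module.

Definition frac (v : M) (s : loc_den) : loc_module :=
  \pi_({eq_quot loc_equiv}) (v, s).

Lemma fracP v s w t :
  frac v s = frac w t <->
  exists u : loc_den, (den u * den t) *: v = (den u * den s) *: w.
Proof.
by split=> [/eqmodP/asboolP //|h]; apply/eqmodP/asboolP.
Qed.

Definition num_den (x : loc_module) : M * loc_den :=
  repr (x : {eq_quot loc_equiv}).

Lemma num_denK x : frac (num_den x).1 (num_den x).2 = x.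
Proof. by rewrite /frac -surjective_pairing; apply: reprK. Qed.

Lemma num_denP v s : exists u : loc_den,
  (den u * den s) *: (num_den (frac v s)).1 = (den u * den (num_den (frac v s)).2) *: v.
Proof. by apply/fracP; rewrite num_denK. Qed.

Definition loc_add (x y : loc_module) : loc_module :=
  frac (den (num_den y).2 *: (num_den x).1
        + den (num_den x).2 *: (num_den y).1)
       (denM (num_den x).2 (num_den y).2).
Definition loc_opp (x : loc_module) : loc_module :=
  frac (- (num_den x).1) (num_den x).2.

Lemma frac_add v s w t :
  loc_add (frac v s) (frac w t) = frac (den t *: v + den s *: w) (denM s t).
Proof.
rewrite /loc_add.
case: (num_denP v s) (num_denP w t) => a ha [b]; move: ha.
case: (num_den (frac v s)) (num_den (frac w t)) => v' s' [w' t'] /= ha hb.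
apply/fracP; exists (denM a b); rewrite !denME !scalerDr !scalerA.
have -> : den a * den b * (den s * den t) * den t' =
        den b * den t * den t' * (den a * den s) :> A by ring.
have -> : den a * den b * (den s * den t) * den s' =
        den a * den s * den s' * (den b * den t) :> A by ring.
rewrite -[_ *: v']scalerA ha -[_ *: w']scalerA hb !scalerA.
by congr (_ *: _ + _ *: _); ring.
Qed.

Lemma frac_opp v s : loc_opp (frac v s) = frac (- v) s.
Proof.
rewrite /loc_opp; case: (num_denP v s).
case: (num_den _) => v' s' /= a ha.
by apply/fracP; exists a; rewrite !scalerN ha.
Qed.

Lemma loc_addA : associative loc_add.
Proof.
move=> x y z; rewrite -[x]num_denK -[y]num_denK -[z]num_denK.
rewrite !frac_add; apply/fracP; exists den1; rewrite !denME.
rewrite !scalerDr !scalerA addrA.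
by congr (_ *: _ + _ *: _ + _ *: _); ring.
Qed.

Lemma loc_addC : commutative loc_add.
Proof.
move=> x y; rewrite -[x]num_denK -[y]num_denK.
rewrite !frac_add; apply/fracP; exists den1; rewrite !denME.
by rewrite addrC; congr (_ *: _); ring.
Qed.

Lemma loc_add0 : left_id (frac 0 den1) loc_add.
Proof.
move=> x; rewrite -[x]num_denK frac_add; apply/fracP; exists den1.
by rewrite !denME den1E scaler0 add0r scalerA; congr (_ *: _); ring.
Qed.

Lemma loc_addN : left_inverse (frac 0 den1) loc_opp loc_add.
Proof.
move=> x; rewrite -[x]num_denK frac_opp frac_add; apply/fracP; exists den1.
by rewrite scalerN addNr !scaler0.
Qed.

HB.instance Definition _ :=
  GRing.isZmodule.Build loc_module loc_addA loc_addC loc_add0 loc_addN.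

Lemma fracD v s w t :
  frac v s + frac w t = frac (den t *: v + den s *: w) (denM s t).
Proof. exact: frac_add. Qed.

Lemma fracDr s v w : frac (v + w) s = frac v s + frac w s.
Proof.
rewrite fracD; apply/fracP; exists den1; rewrite !denME -scalerDr scalerA.
by congr (_ *: _); ring.
Qed.

Lemma frac_ind (Q : loc_module -> Prop) :
  (forall v s, Q (frac v s)) -> forall x, Q x.
Proof. by move=> h x; rewrite -[x]num_denK. Qed.

End Module.

Definition loc_scale (M : lmodType A) (x : loc_module A^o) (y : loc_module M) :
    loc_module M :=
  frac (((num_den x).1 : A) *: (num_den y).1) (denM (num_den x).2 (num_den y).2).

Lemma frac_scale (M : lmodType A) (a : A^o) s (v : M) t :
  loc_scale (frac a s) (frac v t) = frac ((a : A) *: v) (denM s t).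
Proof.
rewrite /loc_scale.
case: (num_denP a s) (num_denP v t) => c hc [d]; move: hc.
case: (num_den (frac a s)) (num_den (frac v t)) => a' s' [v' t'] /= hc hd.
apply/fracP; exists (denM c d); rewrite !denME !scalerA.
have -> : den c * den d * (den s * den t) * a' =
        (den c * den s) * a' * (den d * den t) :> A by ring.
rewrite -scalerA hd scalerA; congr (_ *: _).
by move: hc; rewrite /GRing.scale /= => ->; ring.
Qed.

(* A_P *)
Definition loc_ring : Type := loc_module A^o.
HB.instance Definition _ := GRing.Zmodule.on loc_ring.

Definition loc_mul (x y : loc_ring) : loc_ring := loc_scale x y.
Definition loc_one : loc_ring := frac (1 : A^o) den1.

Lemma loc_scaleA (M : lmodType A) (x y : loc_ring) (v : loc_module M) :
  loc_scale x (loc_scale y v) = loc_scale (loc_mul x y) v.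
Proof.
elim/frac_ind: x => a s; elim/frac_ind: y => b t; elim/frac_ind: v => v r.
rewrite /loc_mul (frac_scale b t v r) (frac_scale a s) (frac_scale a s b t).
rewrite (frac_scale _ _ v r) scalerA; apply/fracP; exists den1.
rewrite (_ : @GRing.scale A A^o a b = (a : A) * (b : A)) //.
by rewrite !denME; congr (_ *: _); ring.
Qed.

Lemma loc_scale1 (M : lmodType A) : left_id loc_one (@loc_scale M).
Proof.
elim/frac_ind => v r; rewrite frac_scale scale1r; apply/fracP; exists den1.
by rewrite !denME den1E !mul1r.
Qed.

Lemma loc_scaleDr (M : lmodType A) : right_distributive (@loc_scale M) +%R.
Proof.
elim/frac_ind => a s; elim/frac_ind => v t; elim/frac_ind => w r.
rewrite fracD !frac_scale fracD; apply/fracP; exists den1.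
rewrite !denME !scalerDr !scalerA.
by congr (_ *: _ + _ *: _); ring.
Qed.

Lemma loc_scaleDl (M : lmodType A) (v : loc_module M) :
  {morph (fun x : loc_ring => loc_scale x v) : x y / x + y}.
Proof.
elim/frac_ind => a s; elim/frac_ind => b t; elim/frac_ind: v => w r.
rewrite [_ + _ in LHS]fracD !frac_scale fracD; apply/fracP; exists den1.
have -> : den t *: a + den s *: b = den t * (a : A) + den s * (b : A) by [].
rewrite !denME scalerDl !scalerDr !scalerA.
by congr (_ *: _ + _ *: _); ring.
Qed.

Lemma loc_mulA : associative loc_mul.
Proof. by move=> x y z; apply: loc_scaleA. Qed.

Lemma loc_mulC : commutative loc_mul.
Proof.
elim/frac_ind => a s; elim/frac_ind => b t.
rewrite /loc_mul !frac_scale; apply/fracP; exists den1; rewrite !denME.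
by rewrite /GRing.scale /=; ring.
Qed.

HB.instance Definition _ := GRing.Zmodule_isComPzRing.Build loc_ring
  loc_mulA loc_mulC (@loc_scale1 A^o) (fun x y v => @loc_scaleDl A^o v x y).

HB.instance Definition _ (M : lmodType A) :=
  GRing.Zmodule_isLmodule.Build loc_ring (loc_module M)
    (@loc_scaleA M) (@loc_scale1 M) (@loc_scaleDr M) (@loc_scaleDl M).

(* The maximal ideal P A_P. *)
Definition loc_max (x : loc_ring) : Prop :=
  exists2 a : A, P a & exists s, x = frac (a : A^o) s.

End Localization.

(* A module M over a Noetherian ring is Cohen-Macaulay if M_P is a
   Cohen-Macaulay A_P-module for every maximal ideal P in its support. *)
Definition cohen_macaulay (A : comPzRingType) (M : lmodType A) : Prop :=
  forall P : prime_ideal A, is_maximal P ->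
    (exists v : loc_module P M, v != 0) ->
    cm_local (loc_module P M) (@loc_max A P).

(* gr_n(J), the direct sum of the n^i J / n^{i+1} J, is the group of polynomials
   p over A with p_i in n^i J, modulo those with p_i in n^{i+1} J. *)
Section AssociatedGraded.
Variables (A : comNzRingType) (n : ideal A).

Section Group.
Variable J : ideal A.

Definition rees_pred : {pred {poly A}} :=
  fun p => `[< forall i, pow_mul n i J p`_i >].

Lemma rees_predP (p : {poly A}) : reflect (forall i, pow_mul n i J p`_i) (p \in rees_pred).
Proof. exact: asboolP. Qed.

Lemma rees_pred_zmod_closed : zmod_closed rees_pred.
Proof.
split=> [|p q /rees_predP hp /rees_predP hq]; apply/rees_predP => i.
  by rewrite coef0; apply: ideal0.
by rewrite coefB; apply: idealB.
Qed.
HB.instance Definition _ :=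
  GRing.isZmodClosed.Build _ rees_pred rees_pred_zmod_closed.

Record rees := Rees { rees_val : {poly A}; reesP : rees_val \in rees_pred }.
HB.instance Definition _ := [isSub for rees_val].
HB.instance Definition _ := [Choice of rees by <:].
HB.instance Definition _ := [SubChoice_isSubZmodule of rees by <:].

Lemma rees_coef p i : pow_mul n i J (rees_val p)`_i.
Proof. by move: i; apply/rees_predP; apply: reesP. Qed.

Lemma rees_val0 : rees_val 0 = 0.
Proof. exact: (raddf0 (\val : {additive rees -> {poly A}})). Qed.
Lemma rees_valB p q : rees_val (p - q) = rees_val p - rees_val q.
Proof. exact: (raddfB (\val : {additive rees -> {poly A}})). Qed.

Definition rees_shift : {pred rees} :=
  fun p => `[< forall i, pow_mul n i.+1 J (rees_val p)`_i >].

Lemma rees_shiftP p :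
  reflect (forall i, pow_mul n i.+1 J (rees_val p)`_i) (p \in rees_shift).
Proof. exact: asboolP. Qed.

Lemma rees_shift_zmod_closed : zmod_closed rees_shift.
Proof.
split=> [|p q /rees_shiftP hp /rees_shiftP hq]; apply/rees_shiftP => i.
  by rewrite rees_val0 coef0; apply: ideal0.
by rewrite rees_valB coefB; apply: idealB.
Qed.
HB.instance Definition _ :=
  GRing.isZmodClosed.Build _ rees_shift rees_shift_zmod_closed.

Definition gr_module : Type := Quotient.quot rees_shift.
HB.instance Definition _ := GRing.Zmodule.on gr_module.

Definition gr_class (p : rees) : gr_module := \pi_(Quotient.quot rees_shift) p.
Definition gr_repr (x : gr_module) : rees := repr (x : Quotient.quot rees_shift).

Lemma gr_reprK x : gr_class (gr_repr x) = x.
Proof. exact: reprK. Qed.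

Lemma gr_classP p q : gr_class p = gr_class q <-> p - q \in rees_shift.
Proof.
by rewrite Quotient.idealrBE; split=> [/eqP|/eqP].
Qed.

Lemma gr_classD p q : gr_class (p + q) = gr_class p + gr_class q.
Proof. exact: (raddfD (\pi_(Quotient.quot rees_shift))). Qed.

Lemma gr_ind (Q : gr_module -> Prop) :
  (forall p, Q (gr_class p)) -> forall x, Q x.
Proof. by move=> h x; rewrite -[x]gr_reprK. Qed.

End Group.

Lemma rees_mul_subproof J (p : rees (unit_ideal A)) (q : rees J) :
  rees_val p * rees_val q \in rees_pred J.
Proof.
apply/rees_predP => i; rewrite coefM; apply: ideal_sum => -[j /= hj] _.
by apply: (@pow_mulM _ _ _ j (i - j)); rewrite ?subnKC //; apply: rees_coef.
Qed.
Definition rees_mul J (p : rees (unit_ideal A)) (q : rees J) : rees J :=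
  Rees (rees_mul_subproof p q).

Definition gr_scale J (x : gr_module (unit_ideal A)) (y : gr_module J) :
  gr_module J := gr_class (rees_mul (gr_repr x) (gr_repr y)).

Lemma gr_class_scale J p (q : rees J) :
  gr_scale (gr_class p) (gr_class q) = gr_class (rees_mul p q).
Proof.
rewrite /gr_scale.
have /gr_classP/rees_shiftP hp := gr_reprK (gr_class p).
have /gr_classP/rees_shiftP hq := gr_reprK (gr_class q).
move: hp hq; move: (gr_repr (gr_class p)) (gr_repr (gr_class q)) => p' q' hp hq.
apply/gr_classP/rees_shiftP => i; rewrite rees_valB.
have -> : rees_val (rees_mul p' q') - rees_val (rees_mul p q) =
  (rees_val p' - rees_val p) * rees_val q'
  + rees_val p * (rees_val q' - rees_val q).
  by rewrite mulrBl mulrBr addrA addrNK.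
rewrite coefD !coefM.
apply: idealD; apply: (ideal_sum (I := pow_mul n i.+1 J)) => j _.
all: have hj : (j <= i)%N by rewrite -ltnS.
- apply: (@pow_mulM _ _ _ j.+1 (i - j)); first by rewrite addSn subnKC.
    2: exact: rees_coef.
  by have := hp j; rewrite rees_valB.
- apply: (@pow_mulM _ _ _ j (i - j).+1); first by rewrite addnS subnKC.
    exact: rees_coef.
  by have := hq (i - j)%N; rewrite rees_valB.
Qed.

(* gr_n(A), where n^i A = n^i. *)
Definition gr_ring : Type := gr_module (unit_ideal A).
HB.instance Definition _ := GRing.Zmodule.on gr_ring.

Lemma rees1_subproof : 1 \in rees_pred (unit_ideal A).
Proof.
apply/rees_predP => -[|i] //; rewrite coef1; exact: ideal0.
Qed.
Definition gr_mul (x y : gr_ring) : gr_ring := gr_scale x y.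
Definition gr_one : gr_ring := gr_class (Rees rees1_subproof).

Lemma gr_scaleA J (x y : gr_ring) (v : gr_module J) :
  gr_scale x (gr_scale y v) = gr_scale (gr_mul x y) v.
Proof.
elim/gr_ind: x => x; elim/gr_ind: y => y; elim/gr_ind: v => v.
rewrite /gr_mul (gr_class_scale y v) (gr_class_scale x y).
rewrite (gr_class_scale x) (gr_class_scale _ v).
by congr gr_class; apply: val_inj; rewrite /= mulrA.
Qed.

Lemma gr_scale1 J : left_id gr_one (@gr_scale J).
Proof.
elim/gr_ind=> v; rewrite gr_class_scale.
by congr gr_class; apply: val_inj; rewrite /= mul1r.
Qed.

Lemma gr_scaleDr J : right_distributive (@gr_scale J) +%R.
Proof.
elim/gr_ind=> x; elim/gr_ind=> v; elim/gr_ind=> w.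
rewrite -gr_classD (gr_class_scale x (v + w)) (gr_class_scale x v).
rewrite (gr_class_scale x w) -gr_classD.
by congr gr_class; apply: val_inj; rewrite /= mulrDr.
Qed.

Lemma gr_scaleDl J (v : gr_module J) :
  {morph (fun x : gr_ring => gr_scale x v) : x y / x + y}.
Proof.
elim/gr_ind=> x; elim/gr_ind=> y; elim/gr_ind: v => v.
rewrite -[X in gr_scale X _]gr_classD (gr_class_scale (x + y) v).
rewrite (gr_class_scale x v) (gr_class_scale y v) -gr_classD.
by congr gr_class; apply: val_inj; rewrite /= mulrDl.
Qed.

Lemma gr_mulA : associative gr_mul.
Proof. by move=> x y z; apply: gr_scaleA. Qed.

Lemma gr_mulC : commutative gr_mul.
Proof.
elim/gr_ind=> x; elim/gr_ind=> y.
rewrite /gr_mul (gr_class_scale x y) (gr_class_scale y x).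
by congr gr_class; apply: val_inj; rewrite /= mulrC.
Qed.

HB.instance Definition _ := GRing.Zmodule_isComPzRing.Build gr_ring
  gr_mulA gr_mulC (@gr_scale1 (unit_ideal A))
  (fun x y v => @gr_scaleDl (unit_ideal A) v x y).

HB.instance Definition _ (J : ideal A) :=
  GRing.Zmodule_isLmodule.Build gr_ring (gr_module J)
    (@gr_scaleA J) (@gr_scale1 J) (@gr_scaleDr J) (@gr_scaleDl J).

End AssociatedGraded.

(* iota : k -> R embeds k as a field contained in R; the composite
   k -> R -> R/m is bijective. *)
Definition coefficient_field (k : fieldType) (R : comNzRingType)
  (iota : {rmorphism k -> R}) (m : ideal R) : Prop :=
  forall r : R, exists! c : k, m (r - iota c).

Section FieldPlusIdeal.
Variables (k : fieldType) (R : comNzRingType) (iota : {rmorphism k -> R}).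
Variable I : ideal R.

Definition kplus_pred : {pred R} := fun r => `[< exists c : k, I (r - iota c) >].

Lemma kplus_predP r :
  reflect (exists c : k, I (r - iota c)) (r \in kplus_pred).
Proof. exact: asboolP. Qed.

Lemma kplus_subring_closed : subring_closed kplus_pred.
Proof.
split=> [|a b /kplus_predP[c hc] /kplus_predP[d hd]|
          a b /kplus_predP[c hc] /kplus_predP[d hd]]; apply/kplus_predP.
- by exists 1; rewrite rmorph1 subrr; apply: ideal0.
- exists (c - d).
  have -> : a - b - iota (c - d) = (a - iota c) - (b - iota d).
    by rewrite rmorphB; ring.
  exact: idealB.
- exists (c * d).
  have -> : a * b - iota (c * d) = b * (a - iota c) + iota c * (b - iota d).
    by rewrite rmorphM; ring.
  by apply: idealD; apply: idealMl.
Qed.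
HB.instance Definition _ :=
  GRing.isSubringClosed.Build R kplus_pred kplus_subring_closed.

(* The subring k + I of R. *)
Record kplus := Kplus { kplus_val : R; kplusP : kplus_val \in kplus_pred }.
HB.instance Definition _ := [isSub for kplus_val].
HB.instance Definition _ := [Choice of kplus by <:].
HB.instance Definition _ := [SubChoice_isSubComNzRing of kplus by <:].

(* The ideal of k + I obtained by intersecting L with it; for L contained in I
   this is L itself. *)
Definition kplus_ideal (L : ideal R) : ideal kplus :=
  ideal_comap (\val : {rmorphism kplus -> R}) L.

End FieldPlusIdeal.

(* Main.v *)
(* Dividing by the non-zero-divisor [x] identifies gr_n(J) with
   M = ⊕ I^i/I^(i+1), a module over G = gr_n(U) = k ⊕ I/I^2 ⊕ ....
   Let T be the class of [x] in degree 1 of G. Since I^(N+1) = x I^N, all powers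
   of I are Ratliff-Rush closed iff T is a non-zero-divisor on M.

   An element of G whose degree-0 part is nonzero is a non-zero-divisor on any
   such graded module, by comparing lowest-degree components. Hence, at every
   maximal ideal P other than G_+, M_P always has depth >= 1; it is moreover
   cyclic, which gives M_P <> u M_P without Nakayama. At G_+ the depth is
   positive iff T is regular, as a power of every element of G_+ lies in T G.

   For the bound on dimension and depth, dim_k I^i/I^(i+1) is bounded, so any
   a, b in G satisfy a nontrivial polynomial relation over k; its lowest term
   gives a^r (b^n (1 + b c) + a e) = 0, which excludes both prime chains of
   length 2 and regular sequences of length 2 in every localization. *)

Require Import Defs.
From mathcomp Require Import all_boot all_algebra.
From mathcomp Require Import ring zify.
From mathcomp Require Import boolp classical_sets cardinality.
(* [fraction] shadows [frac]. *)
Import Defs.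

Set Implicit Arguments.
Unset Strict Implicit.
Unset Printing Implicit Defensive.

Import GRing.Theory.
Local Open Scope ring_scope.

(** * Primes, dimension at most one, and localization *)

Section PrimeExistence.
Variable A : comPzRingType.

(** Zorn's lemma. [S] is arbitrary, so that the singleton of 1 gives maximal ideals and a
    multiplicative set gives primes. *)
Lemma exists_maximal_disjoint (I0 : ideal A) (S : A -> Prop) :
  (forall a, I0 a -> ~ S a) ->
  exists Q : ideal A, [/\ forall a, I0 a -> Q a, forall a, Q a -> ~ S a &
    forall Q' : ideal A, (forall a, Q a -> Q' a) ->
      (forall a, Q' a -> ~ S a) -> forall a, Q' a -> Q a].
Proof.
move=> disj.
(* Joining [I0] to [X] makes the empty chain harmless. *)
pose good (X : set A) := is_ideal (fun a => I0 a \/ X a) /\ forall a, X a -> ~ S a.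
have [|X [[idX dX] maxX]] := @Zorn_bigcup A good.
  move=> F Fgood Ftot; split; last by move=> a [X /Fgood[_ h] /h].
  split; first by left; apply: ideal0.
  - move=> a b [Ia|[X FX Xa]] [Ib|[Y FY Yb]].
    + by left; apply: idealD.
    + have [[_ /(_ a b) h _] _] := Fgood _ FY.
      by case: h => [||?|?]; [left|right|left|right; exists Y].
    + have [[_ /(_ a b) h _] _] := Fgood _ FX.
      by case: h => [||?|?]; [right|left|left|right; exists X].
    + have [XY|YX] := Ftot _ _ FX FY.
        have [[_ /(_ a b) h _] _] := Fgood _ FY.
        by case: h => [||?|?]; [right; apply: XY|right|left|right; exists Y].
      have [[_ /(_ a b) h _] _] := Fgood _ FX.
      by case: h => [||?|?]; [right|right; apply: YX|left|right; exists X].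
  - move=> c a [Ia|[X FX Xa]]; first by left; apply: idealMl.
    have [[_ _ /(_ c a) h] _] := Fgood _ FX.
    by case: h => [|?|?]; [right|left|right; exists X].
exists (Ideal idX); split=> /=; first by left.
  by move=> a [/disj|/dX].
move=> Q' sub dQ' a Q'a; right; apply: contrapT => nXa.
apply: (maxX Q'); first by split=> [b Xb|/(_ _ Q'a)//]; apply: sub; right.
split=> //; suff -> : (fun a => I0 a \/ Q' a) = Q' by exact: idealP.
apply: funext => b; apply: propext; split=> [[Ib|//]|]; last by right.
by apply: sub; left.
Qed.

Lemma ideal_addKr (I : ideal A) a b : I (a + b) -> I b -> I a.
Proof. by move=> Iab Ib; have := idealB Iab Ib; rewrite addrK. Qed.

Lemma adjoin_subproof (Q : ideal A) a :
  is_ideal (fun y => exists q c, Q q /\ y = q + c * a).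
Proof.
split.
- by exists 0, 0; split; [apply: ideal0 | rewrite mul0r addr0].
- move=> _ _ [q [c [Qq ->]]] [q' [c' [Qq' ->]]]; exists (q + q'), (c + c').
  by split; [apply: idealD | ring].
- move=> d _ [q [c [Qq ->]]]; exists (d * q), (d * c).
  by split; [apply: idealMl | ring].
Qed.
Definition adjoin (Q : ideal A) a : ideal A := Ideal (adjoin_subproof Q a).

Lemma adjoin_sub (Q : ideal A) a b : Q b -> adjoin Q a b.
Proof. by move=> Qb; exists b, 0; rewrite mul0r addr0. Qed.

Lemma adjoin_gen (Q : ideal A) a : adjoin Q a a.
Proof. by exists 0, 1; split; [apply: ideal0 | rewrite mul1r add0r]. Qed.

(** If [a] and [b] lie outside the maximal choice of [Q], adjoining either one meets [S]; the
    product of the two elements met lies in [S], and in [Q] once [a * b] does. *)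
Lemma exists_prime_disjoint (I0 : ideal A) (S : A -> Prop) :
  S 1 -> (forall a b, S a -> S b -> S (a * b)) -> (forall a, I0 a -> ~ S a) ->
  exists Q : ideal A, [/\ forall a, I0 a -> Q a, forall a, Q a -> ~ S a &
    is_prime Q].
Proof.
move=> S1 SM /exists_maximal_disjoint[Q [IQ dQ maxQ]].
exists Q; split=> //; split=> [/dQ //|a b Qab].
have meet c : ~ Q c -> exists d q, S (q + d * c) /\ Q q.
  move=> nQc; apply: contrapT => nS; apply: nQc.
  apply: (maxQ (adjoin Q c)); [exact: adjoin_sub | | exact: adjoin_gen].
  by move=> _ [q [d [Qq ->]]] Sy; apply: nS; exists d, q.
apply: contrapT => /not_orP[/meet[c [q [Sq Qq]]] /meet[d [r [Sr Qr]]]].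
apply: (dQ _ _ (SM _ _ Sq Sr)).
have -> : (q + c * a) * (r + d * b) =
  (r + d * b) * q + c * a * r + c * d * (a * b) by ring.
by apply: idealD; [apply: idealD|]; apply: idealMl.
Qed.

Lemma maximal_prime (m : ideal A) : is_maximal m -> is_prime m.
Proof.
move=> [m1 maxm].
have [||a ma ea|Q [mQ dQ [Q1 prQ]]] := @exists_prime_disjoint m (fun a => a = 1).
- by [].
- by move=> a b -> ->; rewrite mulr1.
- by apply: m1; rewrite -ea.
have Qm := maxm Q mQ Q1.
by split=> // a b /mQ /prQ[/Qm|/Qm]; [left|right].
Qed.

Lemma maximal_inverse (m : ideal A) a : is_maximal m -> ~ m a ->
  exists c, m (1 - c * a).
Proof.
move=> [m1 maxm] nma.
have [[q [c [mq e]]]|n1] := EM (adjoin m a 1).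
  by exists c; rewrite e addrK.
by case: nma; apply: (maxm (adjoin m a)) (adjoin_gen _ _) => //; apply: adjoin_sub.
Qed.

(** A non-unit generates a proper ideal, and a maximal ideal above it can only be [m]. *)
Lemma local_unit (m : ideal A) a : is_local m -> ~ m a -> exists c, c * a = 1.
Proof.
move=> [mmax muniq] nma; apply: contrapT => nunit.
have [|Q [aQ dQ maxQ]] :=
  @exists_maximal_disjoint (principal_ideal a) (fun y => y = 1).
  by move=> _ [r ->] e; apply: nunit; exists r; rewrite mulrC.
have Q1 : ~ Q 1 by move=> /dQ.
apply: nma; apply/(muniq Q); last by apply: aQ; exists 1; rewrite mulr1.
split=> // Q' QQ' Q'1 b; apply: maxQ => // c Q'c ec.
by apply: Q'1; rewrite -ec.
Qed.

Lemma prime_exp (Q : ideal A) a n : is_prime Q -> Q (a ^+ n) -> Q a.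
Proof.
move=> [Q1 prQ]; elim: n => [|n IH]; first by rewrite expr0.
by rewrite exprS => /prQ[|/IH].
Qed.

End PrimeExistence.

(** * Krull dimension at most one through algebraic relations *)

Section DimensionAtMostOne.
Variable A : comPzRingType.

(* The Coquand-Lombardi first-order characterization of Krull dimension <= 1. *)
Definition dim_le1 : Prop := forall a b : A,
  exists r n c e, a ^+ r * (b ^+ n * (1 + b * c) + a * e) = 0.

(** In a chain of three primes take [a] in [P 1] outside [P 0] and [b] in [P 2] outside [P 1].
    Reading the relation modulo [P 0], then modulo [P 1], puts [1 + b * c] in [P 2], hence also
    1. *)
Lemma dim_le1_chain (M : lmodType A) (P : nat -> ideal A) d :
  dim_le1 -> prime_chain M P d -> (d <= 1)%N.
Proof.
move=> K [prP _ incr]; rewrite leqNgt; apply/negP => d2.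
have [P01 [a P1a nP0a]] := incr 0%N (ltnW d2).
have [P12 [b P2b nP1b]] := incr 1%N d2.
have [r [n [c [e rel]]]] := K a b.
have [[_ pr0] [_ pr1] [n21 _]] := And3 (prP 0%N isT) (prP 1%N (ltnW d2)) (prP 2 d2).
have : P 0%N (a ^+ r * (b ^+ n * (1 + b * c) + a * e)) by rewrite rel; apply: ideal0.
move=> /pr0[/(prime_exp (prP 0%N isT))//|/P01 h].
have {h} : P 1%N (b ^+ n * (1 + b * c)).
  by apply: ideal_addKr h _; rewrite mulrC; apply: idealMl.
move=> /pr1[/(prime_exp (prP 1%N (ltnW d2)))//|/P12 h].
by apply: n21; apply: ideal_addKr h _; rewrite mulrC; apply: idealMl.
Qed.

(** For [a], [b] the first two terms, the relation allows cancelling [a ^+ r] on [M] and then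
    [b ^+ n] modulo [a M]. As [1 + b * c] is a unit, [v0] lies in [a M], inside the span it
    avoids. *)
Lemma dim_le1_regular_seq (M : lmodType A) (m : A -> Prop) (s : seq A) :
  dim_le1 -> (forall b c, m b -> exists d, d * (1 + b * c) = 1) ->
  regular_seq M s -> (forall a, a \in s -> m a) -> (size s <= 1)%N.
Proof.
move=> K mrad [reg [v0 nv0]] sm; rewrite leqNgt; apply/negP => s2.
have [r [n [c [e rel]]]] := K s`_0 s`_1.
set a := s`_0 in rel *; set b := s`_1 in rel *.
have span0 (v : M) : seq_span s 0 v <-> v = 0.
  by split=> [[w ->]|->]; [|exists (fun=> 0)]; rewrite big_ord0.
have span1 (v : M) : seq_span s 1 v <-> exists w, v = a *: w.
  split=> [[w ->]|[w ->]]; first by exists (w 0%N); rewrite big_ord1.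
  by exists (fun=> w); rewrite big_ord1.
have reg0 k (v : M) : a ^+ k *: v = 0 -> v = 0.
  elim: k => [|k IH]; first by rewrite scale1r.
  rewrite exprS -scalerA => h; apply: IH.
  by apply/span0; apply: (reg 0%N (ltnW s2)); apply/span0.
have reg1 k (v : M) : (exists w, b ^+ k *: v = a *: w) -> exists w, v = a *: w.
  elim: k => [|k IH] [w]; first by rewrite scale1r => ->; exists w.
  rewrite exprS -scalerA => h; apply: IH.
  by apply/span1; apply: (reg 1%N s2); apply/span1; exists w.
have [d ed] := mrad b c (sm _ (mem_nth 0 s2)).
have [|w ew] := reg1 n v0.
  (* Multiplied by the inverse [d] of [1 + b * c], the relation reads
     [a ^+ r * (b ^+ n + a * d * e) = 0]. *)
  exists (- ((d * e) *: v0)).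
  apply/eqP; rewrite -subr_eq0 scalerN opprK; apply/eqP.
  apply: (reg0 r); rewrite !scalerDr !scalerA -scalerDl.
  have -> : a ^+ r * b ^+ n + a ^+ r * a * (d * e) =
    d * (a ^+ r * (b ^+ n * (1 + b * c) + a * e)).
    transitivity (a ^+ r * b ^+ n * (d * (1 + b * c)) + a ^+ r * a * (d * e)).
      by rewrite ed mulr1.
    by ring.
  by rewrite rel mulr0 scale0r.
apply: nv0; exists (fun i => if i == 0%N then w else 0).
rewrite (bigD1 (Ordinal (ltnW s2))) //= -ew big1 ?addr0 // => i.
by rewrite -val_eqE /= => /negPf ->; rewrite scaler0.
Qed.

End DimensionAtMostOne.

(** * Localization at a prime *)

Section LocalizationFacts.
Variables (A : comPzRingType) (P : prime_ideal A).

Lemma frac_mul (a : A^o) s (b : A^o) t :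
  (frac a s : loc_ring P) * (frac b t : loc_ring P)
  = frac ((a : A) * (b : A) : A^o) (denM s t).
Proof. exact: frac_scale. Qed.

Lemma frac_scaleE (M : lmodType A) (a : A^o) s (v : M) t :
  (frac a s : loc_ring P) *: (frac v t : loc_module P M)
  = frac ((a : A) *: v) (denM s t).
Proof. exact: frac_scale. Qed.

Lemma frac_eq0 (M : lmodType A) (v : M) s :
  frac v s = 0 :> loc_module P M <-> exists u : loc_den P, den u *: v = 0.
Proof.
rewrite -[0]/(frac 0 (den1 P)); split=> [/fracP[u]|[u hu]].
  by rewrite den1E mulr1 scaler0; exists u.
by apply/fracP; exists u; rewrite den1E mulr1 scaler0.
Qed.

Lemma prime_notM a b : ~ P a -> ~ P b -> ~ P (a * b).
Proof. by case: (primeP P) => _ h na nb /h[]. Qed.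

Definition mkden a (na : ~ P a) : loc_den P := exist _ a (asboolT na).

(** Primality of [P] removes denominators, so any numerator decides membership. *)
Lemma loc_max_frac (a : A) s : @loc_max A P (frac (a : A^o) s) <-> P a.
Proof.
split=> [[b Pb [t /fracP[u]]]|Pa]; last by exists a => //; exists s.
rewrite /GRing.scale /= => e.
have: P (den u * den t * a) by rewrite e; apply: idealMl.
by case: (primeP P) => _ h /h[/h[/denP|/denP]|].
Qed.

Lemma loc_max_ideal : is_ideal (@loc_max A P).
Proof.
split.
- by apply/(loc_max_frac 0 (den1 P)); apply: ideal0.
- elim/frac_ind => a s; elim/frac_ind => b t /loc_max_frac Pa /loc_max_frac Pb.
  rewrite fracD; apply/(loc_max_frac (den t * a + den s * b)).
  by apply: idealD; apply: idealMl.
- elim/frac_ind => a s; elim/frac_ind => b t /loc_max_frac Pb.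
  by rewrite frac_mul; apply/loc_max_frac; apply: idealMl.
Qed.
Definition loc_maxI : ideal (loc_ring P) := Ideal loc_max_ideal.

Lemma loc_max_prime : is_prime loc_maxI.
Proof.
case: (primeP P) => P1 prP; split=> /=.
  by rewrite -[1]/(frac (1 : A^o) (den1 P)) loc_max_frac.
elim/frac_ind => a s; elim/frac_ind => b t.
by rewrite frac_mul !loc_max_frac; apply: prP.
Qed.

Lemma loc_unit (y : loc_ring P) : ~ loc_maxI y -> exists z, z * y = 1.
Proof.
elim/frac_ind: y => a s /= nPy.
have na : ~ P a by move=> Pa; apply: nPy; apply/loc_max_frac.
exists (frac (den s : A^o) (mkden na)); rewrite frac_mul.
by apply/fracP; exists (den1 P); rewrite /GRing.scale /= /den /=; ring.
Qed.

Lemma loc_max_radical (b c : loc_ring P) : loc_maxI b ->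
  exists d, d * (1 + b * c) = 1.
Proof.
move=> mb; apply: loc_unit => h; case: loc_max_prime => n1 _; apply: n1.
by apply: ideal_addKr h _; rewrite mulrC; apply: idealMl.
Qed.

(** Numerators are unit multiples of their fractions; in the relation for the numerators these units
    can be moved into [c] and [e]. *)
Lemma dim_le1_loc : dim_le1 A -> dim_le1 (loc_ring P).
Proof.
move=> K; elim/frac_ind => a s; elim/frac_ind => b t.
have [r [n [c [e rel]]]] := K a b.
pose j (y : A) : loc_ring P := frac (y : A^o) (den1 P).
have jM y z : j (y * z) = j y * j z.
  by rewrite /j frac_mul; apply/fracP; exists (den1 P); rewrite /GRing.scale /= /den /=; ring.
have jD y z : j (y + z) = j y + j z by apply: fracDr.
have j1 : j 1 = 1 by [].
have jX y k : j (y ^+ k) = j y ^+ k.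
  by elim: k => [|k IH]; rewrite ?expr0 // !exprS jM IH.
have inv (u : loc_den P) : exists w, w * j (den u) = 1.
  apply: loc_unit => h; apply: (denP (s := u)); apply/loc_max_frac; exact: h.
have split_frac y (u : loc_den P) : j y = j (den u) * frac (y : A^o) u.
  by rewrite /j frac_mul; apply/fracP; exists (den1 P); rewrite /GRing.scale /= /den /=; ring.
have {rel} : j (a ^+ r * (b ^+ n * (1 + b * c) + a * e)) = 0.
  by rewrite rel; apply/frac_eq0; exists (den1 P); rewrite scaler0.
rewrite jM jX jD jM jX jD j1 !jM (split_frac a s) (split_frac b t).
set al : loc_ring P := frac _ s; set be : loc_ring P := frac _ t => rel.
have [[s' es] [t' et]] := (inv s, inv t).
exists r, n, (j (den t) * j c), (t' ^+ n * j (den s) * j e).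
have esr k : s' ^+ k * j (den s) ^+ k = 1 by rewrite -exprMn es expr1n.
have etn k : t' ^+ k * j (den t) ^+ k = 1 by rewrite -exprMn et expr1n.
rewrite -[RHS](mulr0 (s' ^+ r * t' ^+ n)) -rel !exprMn.
transitivity ((s' ^+ r * j (den s) ^+ r) * al ^+ r *
  ((t' ^+ n * j (den t) ^+ n) * be ^+ n * (1 + be * (j (den t) * j c))
   + al * (t' ^+ n * j (den s) * j e))).
  by rewrite esr etn !mul1r.
by ring.
Qed.

(** A prime over the annihilator that avoids every [u * al ^+ j], [u] outside the maximal ideal, is
    contained in the maximal ideal, strictly because it omits [al]. *)
Lemma loc_prime_chain (N : lmodType (loc_ring P)) (al : loc_ring P) :
  loc_maxI al ->
  (forall u j, ~ loc_maxI u -> ~ annihilates N (u * al ^+ j)) ->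
  exists Q, prime_chain N Q 1.
Proof.
move=> mal nann.
have idann : is_ideal (annihilates N).
  split=> [v|a b ha hb v|c a ha v]; first by rewrite scale0r.
    by rewrite scalerDl ha hb addr0.
  by rewrite -scalerA ha scaler0.
have [|||Q [annQ dQ prQ]] := @exists_prime_disjoint _ (Ideal idann)
  (fun y => exists u j, ~ loc_maxI u /\ y = u * al ^+ j).
- by exists 1, 0%N; rewrite mulr1; split=> //; case: loc_max_prime.
- move=> _ _ [u [i [nu ->]]] [w [j [nw ->]]]; exists (u * w), (i + j)%N.
  by split; [move=> /(proj2 loc_max_prime)[] | rewrite exprD; ring].
- by move=> y ann [u [j [nu e]]]; apply: (nann u j nu); rewrite -e.
exists (fun i => if i == 0%N then Q else loc_maxI); split.
- by case=> [|i] //= _; exact: loc_max_prime.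
- exact: annQ.
- case=> //= _; split.
    move=> a Qa; apply: contrapT => na; apply: (dQ a Qa).
    by exists a, 0%N; rewrite mulr1.
  exists al => // Qal; apply: (dQ al Qal); exists 1, 1%N; rewrite mul1r.
  by split=> //; case: loc_max_prime.
Qed.

(** A regular element [al] with [al N] proper makes depth and dimension at least 1; the relations in
    [A] pass to the localization and bound both by 1. *)
Lemma cm_local_dim1 (N : lmodType (loc_ring P)) (al : loc_ring P) (v0 : N) :
  dim_le1 A -> loc_maxI al -> (forall v : N, al *: v = 0 -> v = 0) ->
  (forall w, v0 <> al *: w) -> cm_local N (@loc_max A P).
Proof.
move=> /dim_le1_loc K mal reg nv0; exists 1%N; split.
- exists [:: al] => //; split; last by move=> a; rewrite inE => /eqP ->.
  split=> [[|//] _ v [w]|].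
    rewrite big_ord0 /= => /reg ->; exists (fun=> 0).
    by rewrite big_ord0.
  by exists v0 => -[w]; rewrite big_ord1 /=; apply: nv0.
- move=> s sreg sm.
  by apply: (dim_le1_regular_seq K _ sreg sm) => b c; exact: loc_max_radical.
- apply: (loc_prime_chain mal) => u j nu ann.
  have [z ez] := loc_unit nu.
  have al0 i (v : N) : al ^+ i *: v = 0 -> v = 0.
    elim: i => [|i IH]; first by rewrite scale1r.
    by rewrite exprS -scalerA => /reg /IH.
  apply: (nv0 v0).
  have -> : v0 = 0.
    apply: (al0 j); rewrite -[_ *: _]scale1r -ez -scalerA.
    by rewrite [u *: _]scalerA ann scaler0.
  by rewrite scaler0.
- by move=> Q e; apply: dim_le1_chain.
Qed.

End LocalizationFacts.

(** * Linear relations, powers of ideals, finite spans *)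

Section LinearRelations.

(** [lam] is a nonzero vector in the left kernel of a matrix with more rows than columns. *)
Lemma exists_linear_relation (k : fieldType) (X Y : finType) (C : X -> Y -> k) :
  (#|Y| < #|X|)%N ->
  exists2 lam : X -> k, exists x, lam x != 0 &
    forall y, \sum_x lam x * C x y = 0.
Proof.
move=> ltYX; pose B := \matrix_(i < #|X|, j < #|Y|) C (enum_val i) (enum_val j).
have : kermx B != 0.
  by rewrite kermx_eq0 /row_free neq_ltn (leq_ltn_trans (rank_leq_col B) ltYX).
case/rowV0Pn=> v /sub_kermxP vB0 /rV0Pn[i vi].
exists (fun x => v 0 (enum_rank x)); first by exists (enum_val i); rewrite enum_valK.
move=> y; have /rowP/(_ (enum_rank y)) := vB0.
rewrite !mxE (reindex (@enum_val X X)) /=; last exact: onW_bij (@enum_val_bij X).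
by move=> {2}<-; apply: eq_bigr => j _; rewrite mxE enum_valK enum_rankK.
Qed.

Variables (k : fieldType) (A : comPzRingType) (kap : k -> A).
Hypotheses (kap0 : kap 0 = 0) (kap1 : kap 1 = 1).
Hypothesis kapM : forall c d, kap (c * d) = kap c * kap d.

(** [n] is the lowest degree with a nonzero coefficient, and [u] comes from the inverse of that
    coefficient. *)
Lemma lowest_term (b : A) L (f : nat -> k) :
  (exists2 j, (j < L)%N & f j != 0) ->
  exists n c u, u * (\sum_(j < L) kap (f j) * b ^+ j) = b ^+ n * (1 + b * c).
Proof.
elim: L f => [f [] //|L IH f [j jL fj]].
have shift : \sum_(j < L.+1) kap (f j) * b ^+ j =
    kap (f 0%N) + b * (\sum_(j < L) kap (f j.+1) * b ^+ j).
  rewrite big_ord_recl expr0 mulr1; congr (_ + _).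
  by rewrite mulr_sumr; apply: eq_bigr => i _; rewrite exprS mulrCA.
have [f0|f0] := eqVneq (f 0%N) 0.
  case: j jL fj => [|j] jL fj; first by rewrite f0 eqxx in fj.
  have [|n [c [u e]]] := IH (f \o succn); first by exists j.
  by exists n.+1, c, u; rewrite shift f0 kap0 add0r mulrCA e exprS mulrA.
exists 0%N, (kap (f 0%N)^-1 * \sum_(j < L) kap (f j.+1) * b ^+ j), (kap (f 0%N)^-1).
by rewrite shift mulrDr -kapM mulVf // kap1 expr0 mul1r [b * (_ * _)]mulrCA.
Qed.

(** The lowest power of [a] with a nonzero row of coefficients is factored out; [lowest_term]
    normalizes that row and the later rows go into [a * e]. The result has the shape required by
    [dim_le1]. *)
Lemma lowest_term2 (a b : A) K L (g : nat -> nat -> k) :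
  (exists2 i, (i < K)%N & exists2 j, (j < L)%N & g i j != 0) ->
  exists r n c e u, u * (\sum_(i < K) a ^+ i * \sum_(j < L) kap (g i j) * b ^+ j)
    = a ^+ r * (b ^+ n * (1 + b * c) + a * e).
Proof.
elim: K g => [g [] //|K IH g [i iK gi]].
have shift : \sum_(i < K.+1) a ^+ i * (\sum_(j < L) kap (g i j) * b ^+ j) =
    \sum_(j < L) kap (g 0%N j) * b ^+ j
    + a * (\sum_(i < K) a ^+ i * (\sum_(j < L) kap (g i.+1 j) * b ^+ j)).
  rewrite big_ord_recl expr0 mul1r; congr (_ + _).
  by rewrite mulr_sumr; apply: eq_bigr => l _; rewrite exprS mulrA.
have [g0|g0] := EM (exists2 j, (j < L)%N & g 0%N j != 0).
  have [n [c [u e]]] := lowest_term b g0.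
  exists 0%N, n, c, (u * \sum_(i < K) a ^+ i * (\sum_(j < L) kap (g i.+1 j) * b ^+ j)), u.
  by rewrite shift mulrDr e expr0 mul1r [a * (u * _)]mulrCA.
case: i iK gi => [//|i] iK gi.
have [|r [n [c [e [u eq]]]]] := IH (g \o succn); first by exists i.
exists r.+1, n, c, e, u; rewrite shift big1 => [|j _].
  by rewrite add0r mulrCA eq exprS mulrA.
have -> : g 0%N j = 0; last by rewrite kap0 mul0r.
by apply/eqP; apply: contrapT => /negP g0j; apply: g0; exists j.
Qed.

End LinearRelations.

(** * Powers of ideals and reductions *)

Section IdealPowers.
Variable A : comPzRingType.
Implicit Types I J L : ideal A.

Lemma ideal_mulM I J a b : I a -> J b -> ideal_mul I J (a * b).
Proof.
move=> Ia Jb; exists [:: (a, b)]; last by rewrite big_seq1.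
by move=> p; rewrite inE => /eqP ->.
Qed.

Lemma ideal_mul_ind I J (K : A -> Prop) : K 0 ->
  (forall a b, K a -> K b -> K (a + b)) ->
  (forall a b, I a -> J b -> K (a * b)) -> forall a, ideal_mul I J a -> K a.
Proof.
move=> K0 KD KM _ [s hs ->]; elim: s hs => [|p s IH] hs; first by rewrite big_nil.
rewrite big_cons; apply: KD; last by apply: IH => q qs; apply: hs; rewrite inE qs orbT.
by have [] := hs p (mem_head _ _); apply: KM.
Qed.

Lemma ideal_pow_le I i j a : (i <= j)%N -> ideal_pow I j a -> ideal_pow I i a.
Proof.
move=> /subnK <-; elim: (j - i)%N a => [//|d IH] a.
rewrite addSn; apply: ideal_mul_ind; [exact: ideal0|exact: idealD|].
by move=> b c _ /IH; apply: idealMl.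
Qed.

Lemma ideal_powD I i j a b :
  ideal_pow I i a -> ideal_pow I j b -> ideal_pow I (i + j) (a * b).
Proof. exact: pow_mulM. Qed.

Lemma ideal_pow1 I a : ideal_pow I 1 a <-> I a.
Proof.
split=> [|Ia]; last by rewrite -[a]mulr1; apply: ideal_mulM.
apply: ideal_mul_ind; [exact: ideal0|exact: idealD|].
by move=> b c Ib _; rewrite mulrC; apply: idealMl.
Qed.

Lemma ideal_powX I a i : I a -> ideal_pow I i (a ^+ i).
Proof. by move=> Ia; elim: i => [//|i IH]; rewrite exprS; apply: ideal_mulM. Qed.

Lemma ideal_pow_split I i j a :
  ideal_pow I (i + j) a -> ideal_mul (ideal_pow I i) (ideal_pow I j) a.
Proof.
elim: i a => [|i IH] a; first by move=> Ia; rewrite -[a]mul1r; apply: ideal_mulM.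
rewrite addSn; apply: ideal_mul_ind; [exact: ideal0|exact: idealD|].
move=> b c Ib /IH; move: c; apply: ideal_mul_ind.
- by rewrite mulr0; apply: ideal0.
- by move=> c d; rewrite mulrDr; apply: idealD.
- by move=> c d Ic Id; rewrite mulrA; apply: ideal_mulM => //; apply: ideal_mulM.
Qed.

Lemma ideal_powM I i j a : ideal_pow (ideal_pow I i) j a <-> ideal_pow I (i * j) a.
Proof.
elim: j a => [|j IH] a; first by rewrite muln0.
rewrite mulnS; split.
  apply: ideal_mul_ind; [exact: ideal0|exact: idealD|].
  by move=> b c Ib /IH Ic; apply: ideal_powD.
move/ideal_pow_split; apply: ideal_mul_ind; [exact: ideal0|exact: idealD|].
by move=> b c Ib /IH Ic; apply: ideal_mulM.
Qed.

(** Multiplication by [I] carries [I^(N+1) = x I^N] to all later exponents. *)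
Lemma reduction_step I x N : I x ->
  (forall a, ideal_pow I N.+1 a <-> exists2 b, ideal_pow I N b & a = x * b) ->
  forall i, (N <= i)%N -> forall a, ideal_pow I i.+1 a ->
  exists2 b, ideal_pow I i b & a = x * b.
Proof.
move=> Ix red i /subnK <-; elim: (i - N)%N => [|d IH] a; first by move=> /red.
rewrite addSn.
apply: (@ideal_mul_ind _ _ (fun a => exists2 b, ideal_pow I (d.+1 + N) b & a = x * b)).
- by exists 0; [apply: ideal0 | rewrite mulr0].
- move=> _ _ [b Ib ->] [c Ic ->]; exists (b + c); last by rewrite mulrDr.
  exact: idealD.
- move=> b c Ib /IH[d' Id ->]; exists (b * d'); last by rewrite mulrCA.
  exact: ideal_mulM.
Qed.

Lemma generator_mem L (s : seq A) y :
  (forall a, L a <-> exists c : nat -> A, a = \sum_(i < size s) c i * s`_i) ->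
  y \in s -> L y.
Proof.
move=> gen /(nthP 0)[i i_s <-]; apply/gen; exists (fun j => (j == i)%:R).
rewrite (bigD1 (Ordinal i_s)) //= eqxx mul1r big1 ?addr0 // => j.
by rewrite -val_eqE /= => /negPf ->; rewrite mul0r.
Qed.

End IdealPowers.

(** * Finite-dimensional quotients over [k] *)

Section FiniteSpans.
Variables (k : fieldType) (R : comNzRingType) (iota : {rmorphism k -> R}).

(* [r] lies in [H] plus the [k]-span of [F]. *)
Fixpoint span_mod (H : R -> Prop) (F : seq R) (r : R) : Prop :=
  if F is f :: F' then exists c, span_mod H F' (r - iota c * f) else H r.

Lemma span_mod_cat H F G r :
  span_mod H (F ++ G) r <-> span_mod (span_mod H G) F r.
Proof.
elim: F r => [//|f F IH] r /=.
by split=> -[c /IH h]; exists c.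
Qed.

Lemma span_mod_sub (H K : R -> Prop) F r : (forall a, H a -> K a) ->
  span_mod H F r -> span_mod K F r.
Proof.
by move=> sub; elim: F r => [|f F IH] r /=; [apply: sub | case=> c /IH; exists c].
Qed.

(** If [a] is what remains of [w] after subtracting a combination of [F], then [z + y * (a - w)] is
    what remains of [z] after subtracting the same combination of the [y * f]. *)
Lemma span_mod_map (H K : R -> Prop) F y w z : span_mod H F w ->
  (forall a, H a -> K (z + y * (a - w))) -> span_mod K [seq y * f | f <- F] z.
Proof.
elim: F w z => [|f F IH] w z /= => [Hw /(_ _ Hw)|[c Fw] h].
  by rewrite subrr mulr0 addr0.
exists c; apply: IH Fw _ => a /h.
by congr K; ring.
Qed.

Lemma span_mod_shift (H : ideal R) F h r : H h ->
  span_mod H F r -> span_mod H F (r + h).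
Proof.
move=> Hh; elim: F r => [|f F IH] r /= => [Hr|[c /IH Fr]]; first exact: idealD.
by exists c; rewrite addrAC.
Qed.

Lemma span_mod_pad H F d r : span_mod H F r -> span_mod H (nseq d 0 ++ F) r.
Proof. by elim: d => [//|d IH] /IH h /=; exists 0; rewrite mulr0 subr0. Qed.

Lemma span_mod_sum H F r : span_mod H F r ->
  exists c : nat -> k, H (r - \sum_(j < size F) iota (c j) * F`_j).
Proof.
elim: F r => [|f F IH] r /= => [Hr|[c /IH[d Hd]]].
  by exists (fun=> 0); rewrite big_ord0 subr0.
exists (fun j => if j is j'.+1 then d j' else c).
by rewrite big_ord_recl /= opprD addrA.
Qed.

Definition cofinite (H : ideal R) : Prop := exists F, forall r, span_mod H F r.

(** Filter [R] by the ideals [H + y^i R]: if [F] spans [R] modulo [H + y R], then [y^i F] spans each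
    successive quotient, and the filtration reaches [H] at [i = p]. *)
Lemma cofinite_adjoin (H : ideal R) y p : H (y ^+ p) ->
  cofinite (adjoin H y) -> cofinite H.
Proof.
move=> Hyp [F spanF].
suff [G spanG] : exists G, forall r, span_mod (fun z => exists w, H (z - y ^+ p * w)) G r.
  exists G => r; apply: span_mod_sub (spanG r) => z [w Hz].
  by rewrite -[z](subrK (y ^+ p * w)); apply: idealD => //; rewrite mulrC; apply: idealMl.
elim: p {Hyp} => [|p [G spanG]].
  by exists [::] => r; exists r; rewrite mul1r subrr; apply: ideal0.
exists (G ++ [seq y ^+ p * f | f <- F]) => r.
apply/span_mod_cat; apply: span_mod_sub (spanG r) => z [w Hz].
apply: (span_mod_map (spanF w)) => _ [h [c [Hh ->]]]; exists c.
have -> : z + y ^+ p * (h + c * y - w) - y ^+ p.+1 * c =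
  (z - y ^+ p * w) + y ^+ p * h by rewrite exprS; ring.
by apply: idealD => //; apply: idealMl.
Qed.

Lemma cofinite_nilpotent (H : ideal R) (s : seq R) :
  (forall y, y \in s -> exists p, H (y ^+ p)) ->
  cofinite (foldr (fun y K => adjoin K y) H s) -> cofinite H.
Proof.
elim: s => [//|y s IH] nil /= cof; apply: IH.
  by move=> z zs; apply: nil; rewrite inE zs orbT.
have [p Hyp] := nil y (mem_head _ _).
apply: (@cofinite_adjoin _ y p) cof; elim: s {nil} => [//|z s IH] /=.
exact: adjoin_sub.
Qed.

Lemma adjoin_all (H : ideal R) (s : seq R) (c : nat -> R) :
  foldr (fun y K => adjoin K y) H s (\sum_(i < size s) c i * s`_i).
Proof.
elim: s c => [|y s IH] c; first by rewrite big_ord0; apply: ideal0.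
rewrite big_ord_recl; apply: (@idealD _ (adjoin _ y)).
  by apply: idealMl; apply: adjoin_gen.
exact: adjoin_sub (IH (c \o succn)).
Qed.

(** The list [F] consists of the products of the generators of [L] with a finite list spanning
    [R / I]. *)
Lemma cofinite_mul (I L : ideal R) (s : seq R) : cofinite I ->
  (forall a, L a <-> exists c : nat -> R, a = \sum_(i < size s) c i * s`_i) ->
  exists2 F : seq R, (forall f, f \in F -> L f) &
    forall r, L r -> span_mod (ideal_mul I L) F r.
Proof.
move=> [F0 spanF0] gen.
have sL y : y \in s -> L y := generator_mem gen.
suff [F FL spanF] : exists2 F : seq R, (forall f, f \in F -> L f) &
    forall c : nat -> R, span_mod (ideal_mul I L) F (\sum_(i < size s) c i * s`_i).
  by exists F => // r /gen[c ->].
elim: s sL {gen} => [|y s IH] sL.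
  by exists [::] => // c; rewrite big_ord0; apply: ideal0.
have [|F FL spanF] := IH; first by move=> z zs; apply: sL; rewrite inE zs orbT.
have Ly := sL y (mem_head _ _).
exists ([seq y * f | f <- F0] ++ F) => [f|c].
  rewrite mem_cat => /orP[/mapP[g _ ->]|/FL//].
  by rewrite mulrC; apply: idealMl.
apply/span_mod_cat; apply: (span_mod_map (spanF0 (c 0%N))) => a Ia.
have -> : \sum_(i < size (y :: s)) c i * (y :: s)`_i + y * (a - c 0%N) =
  \sum_(i < size s) (c \o succn) i * s`_i + a * y by rewrite big_ord_recl /=; ring.
by apply: span_mod_shift; [apply: ideal_mulM | apply: spanF].
Qed.

End FiniteSpans.

(** * The Ratliff-Rush condition and one-dimensional local rings *)

Section RatliffRush.
Variables (R : comNzRingType) (I : ideal R) (x : R).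
Hypotheses (Ix : I x) (redx : principal_reduction x I).

(* The initial form of [x] is a non-zero-divisor on the associated graded ring
   of [I]. *)
Definition initial_regular : Prop := forall i a,
  ideal_pow I i a -> ideal_pow I i.+2 (x * a) -> ideal_pow I i.+1 a.

Lemma asymptotic_rr_number1 : asymptotic_rr_number I = 1%N <-> rr_closed_from I 1.
Proof.
rewrite /asymptotic_rr_number; split; last first.
  move=> rr1; apply: xget_unique.
    by split=> // n' [n'_gt0 _].
  move=> n [[n_gt0 _] /(_ _ rr1) n_le1].
  by apply/eqP; rewrite eqn_leq n_le1.
(* The default value 0 of [xget] is not 1, so here the minimum is attained. *)
by case: xgetP => [n _ [cn _] <-|].
Qed.

Lemma rr_closed_initial_regular : rr_closed_from I 1 <-> initial_regular.
Proof.
have [N red] := proj2 redx; split.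
  (* With [l + 1 = (i + 1)(N + 1)], the reduction gives [a I^(l+1)] inside [(x a) I^l], hence inside
     [I^(i+2+l) = I^((i+1)(N+2))]. So [a] is in the Ratliff-Rush closure of [I^(i+1)]. *)
  move=> [_ rr] i a Ia Ixa; apply/(rr i.+1) => //.
  exists N.+1 => // b /ideal_powM.
  have [l el Nl] : exists2 l, (i.+1 * N.+1 = l.+1)%N & (N <= l)%N.
    by exists (i * N.+1 + N)%N; lia.
  rewrite el => /(reduction_step Ix red Nl)[c Ic ->]; apply/ideal_powM.
  rewrite mulrA [a * x]mulrC (_ : i.+1 * N.+2 = i.+2 + l)%N; last by lia.
  exact: ideal_powD.
move=> xreg; split=> // l l_gt0 a; split=> [Ia|[n _ h]].
  by exists 1%N => // b Ib; apply: ideal_mulM.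
(* Powers of [x] are cancelled one factor at a time. *)
have step q j b : ideal_pow I j b -> ideal_pow I (q + j.+1) (x ^+ q * b) ->
    ideal_pow I j.+1 b.
  move=> Ib; elim: q => [|q IH]; first by rewrite mul1r.
  rewrite exprS -mulrA addSn addnS => Ixb; apply: IH; rewrite addnS.
  by apply: xreg => //; apply: ideal_powD => //; apply: ideal_powX.
(* [x ^+ (l * n)] lies in [(I^l)^n], so its product with [a] lies in [(I^l)^(n+1)]. The order of [a]
   is then raised one by one up to [l]. *)
have {}h : ideal_pow I (l * n + l) (x ^+ (l * n) * a).
  have /ideal_powM := h (x ^+ (l * n)) (proj2 (ideal_powM _ _ _ _) (ideal_powX _ Ix)).
  by rewrite mulnS addnC mulrC.
suff: forall j, (j <= l)%N -> ideal_pow I j a by apply.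
elim=> [//|j IH] jl; apply: (step (l * n)%N); first exact: IH (ltnW jl).
by apply: ideal_pow_le h; rewrite leq_add2l.
Qed.

End RatliffRush.

(** * Noetherian local rings of dimension one *)

Section OneDimensionalLocal.
Variables (R : comNzRingType) (m : ideal R).
Hypotheses (locm : is_local m) (noeth : noetherian R) (dim1 : has_dim R^o 1).
Variable I : ideal R.
Hypothesis properI : ~ I 1.

Lemma proper_sub_max a : I a -> m a.
Proof.
move=> Ia; apply: contrapT => /(local_unit locm)[c e].
by apply: properI; rewrite -e; apply: idealMl.
Qed.

(** Were no power of [y] in [I], some prime [P] over [I] would omit [y] and lie strictly below [m];
    the non-zero-divisor [x] in [P] would then give a prime [Q] strictly below [P], a chain too long
    for dimension 1. *)
Lemma max_nilpotent x : I x -> GRing.lreg x ->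
  forall y, m y -> exists p, I (y ^+ p).
Proof.
move=> Ix regx y my; apply: contrapT => nil.
have prm : is_prime m by apply: maximal_prime; case: locm.
have m1 : ~ m 1 by case: prm.
have [|||P [IP dP prP]] := @exists_prime_disjoint _ I
  (fun z => exists u j, ~ m u /\ z = u * y ^+ j).
- by exists 1, 0%N; rewrite mulr1.
- move=> _ _ [u [i [nu ->]]] [w [j [nw ->]]]; exists (u * w), (i + j)%N.
  by split; [move=> /(proj2 prm)[] | rewrite exprD; ring].
- move=> z Iz [u [j [/(local_unit locm)[c e] ez]]]; apply: nil; exists j.
  by rewrite -[_ ^+ j]mul1r -e -mulrA -ez; apply: idealMl.
have Pm a : P a -> m a.
  by move=> Pa; apply: contrapT => na; apply: (dP a Pa); exists a, 0%N; rewrite mulr1.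
have nPy : ~ P y by move=> Py; apply: (dP y Py); exists 1, 1%N; rewrite mul1r.
have [|||Q [_ dQ prQ]] := @exists_prime_disjoint _ (principal_ideal 0)
  (fun z => exists u j, ~ P u /\ z = u * x ^+ j).
- by exists 1, 0%N; rewrite mulr1; split=> //; case: prP.
- move=> _ _ [u [i [nu ->]]] [w [j [nw ->]]]; exists (u * w), (i + j)%N.
  by split; [move=> /(proj2 prP)[] | rewrite exprD; ring].
- move=> _ [r ->] [u [j [nu]]]; rewrite mul0r mulrC => /esym e; apply: nu.
  suff -> : u = 0 by apply: ideal0.
  elim: j e => [|j IH]; first by rewrite expr0 mul1r.
  by rewrite exprS -mulrA -[X in _ = X -> _](mulr0 x) => /regx.
suff : (2 <= 1)%N by [].
apply: (proj2 dim1 (fun i => if i is i'.+1 then if i' is 0 then P else m else Q) 2).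
split.
- by case=> [|[|[|]]].
- move=> a /(_ (1 : R^o)); rewrite /GRing.scale /= mulr1 => ->; exact: ideal0.
- case=> [|[|]] //= _; split=> //.
  + move=> a Qa; apply: contrapT => na; apply: (dQ a Qa).
    by exists a, 0%N; rewrite mulr1.
  + exists x => [|Qx]; first exact: IP.
    by apply: (dQ x Qx); exists 1, 1%N; rewrite mul1r; split=> //; case: prP.
  + by exists y.
Qed.

(** The ideals [b i R] increase, and by finite generation their union is one of them. *)
Lemma noetherian_stationary (b : nat -> R) (c : R) :
  (forall i, b i = c * b i.+1) -> exists i r, b i.+1 = b i * r.
Proof.
move=> bc.
have mono i d : exists r, b i = b (i + d)%N * r.
  elim: d => [|d [r e]]; first by exists 1; rewrite addn0 mulr1.
  by exists (c * r); rewrite e {1}bc addnS; ring.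
have idU : is_ideal (fun y => exists i r, y = b i * r).
  split.
  - by exists 0%N, 0; rewrite mulr0.
  - move=> _ _ [i [r ->]] [j [s ->]].
    have [[u eu] [w ew]] := (mono i j, mono j i).
    by exists (i + j)%N, (u * r + w * s); rewrite eu ew [(j + i)%N]addnC; ring.
  - by move=> d _ [i [r ->]]; exists i, (d * r); rewrite mulrCA.
have [s gen] := noeth (Ideal idU).
suff [i hi] : exists i, forall y, y \in s -> exists r, y = b i * r.
  exists i; have /gen[d ->] : Ideal idU (b i.+1) by exists i.+1, 1; rewrite mulr1.
  suff : principal_ideal (b i) (\sum_(l < size s) d l * s`_l) by [].
  apply: ideal_sum => l _; apply: idealMl; apply: hi.
  exact: mem_nth.
have sU y : y \in s -> exists i r, y = b i * r := generator_mem gen.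
elim: s sU {gen} => [|y s IH] sU; first by exists 0%N.
have [|i hi] := IH; first by move=> z zs; apply: sU; rewrite inE zs orbT.
have [j [r ey]] := sU y (mem_head _ _).
exists (i + j)%N => z; rewrite inE => /orP[/eqP->|/hi[q ->]].
  by have [u eu] := mono j i; exists (u * r); rewrite ey eu addnC mulrA.
by have [u ->] := mono i j; exists (u * q); rewrite mulrA.
Qed.

Variable x : R.
Hypotheses (regI : regular_ideal I) (redx : principal_reduction x I).

(** [x] divides a power of a non-zero-divisor lying in [I]. *)
Lemma reduction_regular : GRing.lreg x.
Proof.
have [_ [n red]] := redx; have [a Ia rega] := regI.
have /red[b _ e] := ideal_powX n.+1 Ia.
move=> y z exy; apply: (GRing.lregX (n := n.+1) rega).
by rewrite e mulrAC exy mulrAC.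
Qed.

(** Otherwise [x^j I^N] lies in [I^(j+1+N) = x^(j+1) I^N], and cancelling gives [I^N = x I^N].
    Dividing [x ^+ N] by [x] forever builds an ascending chain of principal ideals; once it is
    stationary a term vanishes, and so does [x ^+ N]. *)
Lemma reduction_pow_notin j : ~ ideal_pow I j.+1 (x ^+ j).
Proof.
move=> h; have [Ix [N red]] := redx; have regx := reduction_regular.
have step i : forall a, ideal_pow I (i + N) a -> exists2 b, ideal_pow I N b & a = x ^+ i * b.
  elim: i => [|i IH] a; first by exists a; rewrite ?mul1r.
  move=> /(reduction_step Ix red (leq_addl i N))[b /IH[c Ic ->] ->].
  by exists c; rewrite // exprS mulrA.
have div b : ideal_pow I N b -> exists c, ideal_pow I N c /\ b = x * c.
  move=> Ib; have /step[c Ic e] := ideal_powD h Ib.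
  exists c; split=> //; apply: (GRing.lregX (n := j) regx).
  by rewrite e exprSr mulrA.
(* [g] divides by [x] on [I^N]; elsewhere its values are arbitrary. *)
have /choice[g gP] : forall b, exists c, ideal_pow I N b -> ideal_pow I N c /\ b = x * c.
  move=> b; have [/div[c h']|nb] := EM (ideal_pow I N b); first by exists c.
  by exists 0.
have iterI i : ideal_pow I N (iter i g (x ^+ N)).
  by elim: i => [|i /gP[]//]; apply: ideal_powX.
have [i|i [r e]] := @noetherian_stationary (fun i => iter i g (x ^+ N)) x.
  by have [] := gP _ (iterI i).
have [|c ec] := @local_unit _ m (1 - x * r) locm.
  have [[m1 _] _] := locm; move=> mu; apply: m1; rewrite -[1](subrK (x * r)).
  by apply: idealD => //; rewrite mulrC; apply: idealMl; apply: proper_sub_max.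
(* This term equals [x * r] times itself, and [1 - x * r] is a unit. *)
have iter0 : iter i.+1 g (x ^+ N) = 0.
  rewrite -[LHS]mul1r -ec -mulrA mulrBl mul1r.
  have {1}-> : iter i.+1 g (x ^+ N) = x * r * iter i.+1 g (x ^+ N).
    rewrite {1}e; have [_ {1}->] := gP _ (iterI i); rewrite -[g _]/(iter i.+1 g _).
    by ring.
  by rewrite subrr mulr0.
have : x ^+ N = 0.
  have {iter0} : iter i.+1 g (x ^+ N) = 0 by [].
  elim: i.+1 => [//|l IH] e0; apply: IH.
  by have [_ ->] := gP _ (iterI l); rewrite -[g _]/(iter l.+1 g _) e0 mulr0.
rewrite -[X in _ = X](mulr0 (x ^+ N)) -[X in X = _]mulr1.
by move=> /(GRing.lregX (n := N) regx)/eqP; rewrite oner_eq0.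
Qed.

Variables (k : fieldType) (iota : {rmorphism k -> R}).
Hypothesis coef : coefficient_field iota m.

(** Once generators of [m] are adjoined to [I], the quotient is spanned by 1, as [k] is the residue
    field. These generators are nilpotent modulo [I], so they can be removed one by one. *)
Lemma cofinite_ideal : cofinite iota I.
Proof.
have [Ix _] := redx; have [s gen] := noeth m.
have sm y : y \in s -> m y := generator_mem gen.
apply: (@cofinite_nilpotent _ _ _ _ s).
  by move=> y /sm; apply: max_nilpotent Ix reduction_regular _.
exists [:: 1] => r /=; have [c [/gen[d e] _]] := coef r; exists c.
by rewrite mulr1 e; apply: adjoin_all.
Qed.

(** From [i = N] on, multiplication by [x] carries a spanning list of [I^i / I^(i+1)] to one of the
    next quotient, so the maximum over [i <= N] serves for all [i]. Lists are padded with zeros to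
    this length. *)
Lemma bounded_dims : exists e, forall i, exists F : seq R,
  [/\ size F = e, forall f, f \in F -> ideal_pow I i f &
      forall r, ideal_pow I i r -> span_mod iota (ideal_pow I i.+1) F r].
Proof.
pose D i e := exists F : seq R,
  [/\ size F = e, forall f, f \in F -> ideal_pow I i f &
      forall r, ideal_pow I i r -> span_mod iota (ideal_pow I i.+1) F r].
have mono i e e' : (e <= e')%N -> D i e -> D i e'.
  move=> le [F [sF FI spF]]; exists (nseq (e' - e) 0 ++ F); split.
  - by rewrite size_cat size_nseq sF subnK.
  - move=> f; rewrite mem_cat mem_nseq => /orP[/andP[_ /eqP->]|/FI//].
    exact: ideal0.
  - by move=> r /spF; apply: span_mod_pad.
have fin i : exists e, D i e.
  have [s gen] := noeth (ideal_pow I i).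
  by have [F FI spF] := cofinite_mul cofinite_ideal gen; exists (size F), F.
have [Ix [N red]] := redx.
have step i e : (N <= i)%N -> D i e -> D i.+1 e.
  move=> Ni [F [sF FI spF]]; exists [seq x * f | f <- F]; split.
  - by rewrite size_map.
  - by move=> _ /mapP[f /FI If ->]; apply: ideal_mulM.
  - move=> r /(reduction_step Ix red Ni)[b Ib ->].
    apply: span_mod_map (spF b Ib) _ => a Ia.
    by rewrite mulrBr addrC subrK; apply: ideal_mulM.
have [e eP] : exists e, forall i, (i <= N)%N -> D i e.
  elim: N {red step} => [|n [e IH]].
    by have [e De] := fin 0%N; exists e; case.
  have [e' De'] := fin n.+1; exists (maxn e e') => i.
  rewrite leq_eqVlt => /orP[/eqP->|].
    exact: mono (leq_maxr _ _) De'.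
  by rewrite ltnS => /IH; apply: mono; apply: leq_maxl.
exists e => i; have [/eP//|/ltnW/subnK <-] := leqP i N.
elim: (i - N)%N => [|d IH]; first exact: eP.
by apply: step IH; apply: leq_addl.
Qed.

End OneDimensionalLocal.

(** * The graded ring of [k + I] *)

Section GradedFacts.
Variables (A : comNzRingType) (n : ideal A).
Hypothesis nmax : is_maximal n.

Lemma gr_scaleE (J : ideal A) (p : rees n (unit_ideal A)) (q : rees n J) :
  (gr_class p : gr_ring n) *: gr_class q = gr_class (rees_mul p q).
Proof. exact: gr_class_scale. Qed.

Lemma gr_mulE (p q : rees n (unit_ideal A)) :
  (gr_class p : gr_ring n) * (gr_class q : gr_ring n) = gr_class (rees_mul p q).
Proof. exact: gr_class_scale. Qed.

Lemma rees_valD (J : ideal A) (p q : rees n J) :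
  rees_val (p + q) = rees_val p + rees_val q.
Proof. exact: (raddfD (\val : {additive rees n J -> {poly A}})). Qed.

Lemma rees_valM (J : ideal A) (p : rees n (unit_ideal A)) (q : rees n J) :
  rees_val (rees_mul p q) = rees_val p * rees_val q.
Proof. by []. Qed.

Lemma gr_class_eq0 (J : ideal A) (q : rees n J) :
  gr_class q = 0 <-> forall i, pow_mul n i.+1 J (rees_val q)`_i.
Proof.
have -> : 0 = gr_class (0 : rees n J) by rewrite -[LHS](subrr (gr_class 0)) -{1}[0]addr0 gr_classD addrK.
by rewrite gr_classP subr0; split=> [/rees_shiftP|h] //; apply/rees_shiftP.
Qed.

Lemma exists_rees_monomial (J : ideal A) i a : pow_mul n i J a ->
  exists p : rees n J, rees_val p = a *: 'X^i.
Proof.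
move=> ha; have hp : a *: 'X^i \in rees_pred n J.
  apply/rees_predP => j; rewrite coefZ coefXn.
  by have [->|_] := eqVneq j i; rewrite ?mulr1 // mulr0; apply: ideal0.
by exists (Rees hp).
Qed.

(* The homogeneous maximal ideal; [rees_shift] only fixes the degree-0
   coefficient modulo [n], hence the choice of a representative. *)
Definition gr_plus_set (a : gr_ring n) : Prop := n (rees_val (gr_repr a))`_0.

Lemma gr_plus_class (p : rees n (unit_ideal A)) :
  gr_plus_set (gr_class p) <-> n (rees_val p)`_0.
Proof.
have /gr_classP/rees_shiftP/(_ 0%N) := gr_reprK (gr_class p).
rewrite rees_valB coefB => /ideal_pow1 h; rewrite /gr_plus_set; split=> h'.
  by rewrite -[_`_0](subKr (rees_val (gr_repr (gr_class p)))`_0); apply: idealB.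
by rewrite -[_`_0](subrK (rees_val p)`_0); apply: idealD.
Qed.

Lemma gr_plus_ideal : is_ideal gr_plus_set.
Proof.
split.
- have /gr_class_eq0/(_ 0%N)/ideal_pow1 := gr_reprK (0 : gr_ring n); exact.
- elim/gr_ind=> p; elim/gr_ind=> q /gr_plus_class hp /gr_plus_class hq.
  rewrite -gr_classD; apply/gr_plus_class.
  rewrite rees_valD coefD.
  exact: idealD.
- elim/gr_ind=> p; elim/gr_ind=> q /gr_plus_class hq.
  rewrite gr_mulE; apply/gr_plus_class.
  by rewrite coef0M; apply: idealMl.
Qed.
Definition gr_plus : ideal (gr_ring n) := Ideal gr_plus_ideal.

Lemma gr_plus1 : ~ gr_plus 1.
Proof.
move/gr_plus_class; rewrite /= coef1 /=.
by case: nmax.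
Qed.

(** An element outside has a degree-0 coefficient invertible modulo [n]; multiplying by an inverse
    in degree 0 gives 1 up to [gr_plus]. *)
Lemma gr_plus_maximal : is_maximal gr_plus.
Proof.
split=> [|K sub K1 a]; first exact: gr_plus1.
elim/gr_ind: a => p Kp; apply: contrapT => /gr_plus_class np; apply: K1.
have [c nc] := maximal_inverse nmax np.
have [q eq] := @exists_rees_monomial (unit_ideal A) 0 c I.
have Kq : K ((gr_class q : gr_ring n) * gr_class p) by apply: idealMl.
rewrite -[1](subrK ((gr_class q : gr_ring n) * gr_class p)); apply: idealD => //.
apply: sub; rewrite gr_mulE -[1]/(gr_class (Rees (rees1_subproof n))).
have -> : gr_class (Rees (rees1_subproof n)) - gr_class (rees_mul q p)
   = gr_class (Rees (rees1_subproof n) - rees_mul q p).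
  by apply/eqP; rewrite subr_eq -gr_classD subrK.
apply/gr_plus_class; rewrite rees_valB coefB /= coef1 coef0M eq.
by rewrite coefZ coefXn mulr1.
Qed.

(* Compare components of lowest degree: the degree-0 part of [s] is a unit
   modulo [n]. *)
Lemma gr_plus_regular (J : ideal A) (s : gr_ring n) (v : gr_module n J) :
  ~ gr_plus s -> s *: v = 0 -> v = 0.
Proof.
elim/gr_ind: s => p; elim/gr_ind: v => q /gr_plus_class np.
rewrite gr_scaleE => /gr_class_eq0 h; apply/gr_class_eq0 => i.
have [c nc] := maximal_inverse nmax np.
elim/ltn_ind: i => i IH.
(* In degree [i] the other terms of the product involve coefficients of [q] of smaller degree,
   already known to lie one step deeper. *)
have {}h : pow_mul n i.+1 J ((rees_val p)`_0 * (rees_val q)`_i).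
  have := h i; rewrite rees_valM coefM big_ord_recl subn0 => /ideal_addKr; apply.
  apply: (@ideal_sum _ _ (pow_mul n i.+1 J)) => j _.
  apply: (@pow_mulM _ _ _ (lift ord0 j) (i - lift ord0 j).+1).
  - by have := ltn_ord j; rewrite lift0; lia.
  - exact: (rees_coef p).
  - by apply: IH; have := ltn_ord j; rewrite lift0; lia.
have -> : (rees_val q)`_i = c * ((rees_val p)`_0 * (rees_val q)`_i)
  + (1 - c * (rees_val p)`_0) * (rees_val q)`_i by ring.
apply: idealD; first exact: idealMl.
by apply: ideal_mulM => //; apply: rees_coef.
Qed.

Lemma gr_plus_exp (a : gr_ring n) d : gr_plus a ->
  exists p : rees n (unit_ideal A), gr_class p = a ^+ d /\
    forall i, (i < d)%N -> (rees_val p)`_i = 0.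
Proof.
elim/gr_ind: a => p /gr_plus_class np.
have [q0 eq0] := @exists_rees_monomial (unit_ideal A) 0 (rees_val p)`_0 I.
have cp' : gr_class (p - q0) = gr_class p :> gr_ring n.
  apply/gr_classP/rees_shiftP => i; rewrite !rees_valB eq0 addrAC subrr sub0r coefN.
  apply: idealN; rewrite coefZ coefXn; case: i => [|i].
    by rewrite mulr1; apply/ideal_pow1.
  by rewrite mulr0; apply: ideal0.
have p'0 : (rees_val (p - q0))`_0 = 0.
  by rewrite rees_valB eq0 coefB coefZ coefXn mulr1 subrr.
elim: d => [|d [q [eq hq]]]; first by exists (Rees (rees1_subproof n)).
exists (rees_mul (p - q0) q); split; first by rewrite -gr_mulE cp' eq exprS.
move=> i id /=; rewrite coefM big1 // => -[[|j] /= ji] _.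
  by rewrite p'0 mul0r.
by rewrite hq ?mulr0 //; lia.
Qed.

End GradedFacts.

(** * The associated graded module of [x R] over [k + I] *)

Section FiberRing.
Variables (k : fieldType) (R : comNzRingType) (iota : {rmorphism k -> R}).
Variables (I : ideal R) (x : R).
Hypotheses (properI : ~ I 1) (Ix : I x) (regx : GRing.lreg x).

Let U := kplus iota I.
Let n : ideal U := kplus_ideal iota I I.
Let J : ideal U := kplus_ideal iota I (principal_ideal x).

Let nE (u : U) : n u = I (val u). Proof. by []. Qed.

Let val0 : val (0 : U) = 0. Proof. exact: (rmorph0 (\val : {rmorphism U -> R})). Qed.
Let val1 : val (1 : U) = 1. Proof. exact: (rmorph1 (\val : {rmorphism U -> R})). Qed.
Let valD (u w : U) : val (u + w) = val u + val w.
Proof. exact: (rmorphD (\val : {rmorphism U -> R})). Qed.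
Let valB (u w : U) : val (u - w) = val u - val w.
Proof. exact: (rmorphB (\val : {rmorphism U -> R})). Qed.
Let valM (u w : U) : val (u * w) = val u * val w.
Proof. exact: (rmorphM (\val : {rmorphism U -> R})). Qed.
Let valX (u : U) i : val (u ^+ i) = val u ^+ i.
Proof. exact: (rmorphXn (\val : {rmorphism U -> R})). Qed.

Lemma kplus_lift r : I r -> exists u : U, val u = r.
Proof.
move=> Ir; have h : r \in kplus_pred iota I.
  by apply/kplus_predP; exists 0; rewrite rmorph0 subr0.
by exists (Kplus h).
Qed.

Lemma kplus_scalar_subproof c : iota c \in kplus_pred iota I.
Proof. by apply/kplus_predP; exists c; rewrite subrr; apply: ideal0. Qed.
Definition kplus_scalar c : U := Kplus (kplus_scalar_subproof c).

Lemma kplus_max : is_maximal n.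
Proof.
split=> [|K sub K1 u Ku]; first by rewrite nE val1.
have [c Ic] := kplus_predP _ _ _ (kplusP u).
have [c0|c0] := eqVneq c 0; first by move: Ic; rewrite c0 rmorph0 subr0.
case: K1; have Kc : K (kplus_scalar c).
  rewrite -[kplus_scalar c](subKr u); apply: idealB => //; apply: sub.
  by rewrite nE valB.
have -> : 1 = kplus_scalar c^-1 * kplus_scalar c :> U.
  by apply: val_inj; rewrite valM val1 /= -rmorphM mulVf // rmorph1.
exact: idealMl.
Qed.

(** Exponent 0 is excluded, as it gives [U] on one side and [R] on the other. Beyond it, [I] is
    contained in [U], so its products are formed there. *)
Lemma kplus_powP i (u : U) : (0 < i)%N ->
  ideal_pow n i u <-> ideal_pow I i (val u).
Proof.
case: i => // i _; split.
  elim: i.+1 u => [//|j IH] u.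
  apply: (@ideal_mul_ind _ _ _ (fun u : U => ideal_pow I j.+1 (val u))).
  - by rewrite val0; apply: ideal0.
  - by move=> a b ha hb; rewrite valD; apply: idealD.
  - by move=> a b na /IH hb; rewrite valM; apply: ideal_mulM.
suff gen r : ideal_pow I i.+1 r -> exists2 w : U, val w = r & ideal_pow n i.+1 w.
  by case/gen=> w /val_inj ->.
elim: i r => [|i IH] r.
  move=> /ideal_pow1 Ir; have [w ew] := kplus_lift Ir.
  by exists w => //; apply/ideal_pow1; rewrite nE ew.
apply: (@ideal_mul_ind _ _ _ (fun r => exists2 w : U, val w = r & ideal_pow n i.+2 w)).
- by exists 0; [rewrite val0 | apply: ideal0].
- move=> _ _ [a <- na] [b <- nb]; exists (a + b); first by rewrite valD.
  exact: idealD.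
- move=> a _ Ia /IH[b <- nb]; have [w ew] := kplus_lift Ia.
  exists (w * b); first by rewrite valM ew.
  by apply: ideal_mulM => //; rewrite nE ew.
Qed.

(** Identifies [gr_n(J)] with the sum of the [I^i / I^(i+1)]. Exponent 0 is allowed because [J] is
    [x R], not [x U]. *)
Lemma kplus_pow_mulP i (u : U) :
  pow_mul n i J u <-> exists2 r, ideal_pow I i r & val u = x * r.
Proof.
split.
  elim: i u => [|i IH] u; first by case=> r eq_u; exists r.
  apply: (@ideal_mul_ind _ _ _ (fun u : U => exists2 r, ideal_pow I i.+1 r & val u = x * r)).
  - by exists 0; [apply: ideal0 | rewrite mulr0 val0].
  - move=> a b [r Ir ea] [s Is eb]; exists (r + s); first exact: idealD.
    by rewrite valD ea eb mulrDr.
  - move=> a b na /IH[r Ir eb]; exists (val a * r); first exact: ideal_mulM.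
    by rewrite valM eb mulrCA.
suff gen r : ideal_pow I i r -> exists2 w : U, val w = x * r & pow_mul n i J w.
  by case=> r /gen[w <- nw] /val_inj ->.
elim: i r => [|i IH] r.
  move=> _; have [w ew] : exists w : U, val w = x * r.
    by apply: kplus_lift; rewrite mulrC; apply: idealMl.
  by exists w => //=; exists r.
apply: (@ideal_mul_ind _ _ _ (fun r => exists2 w : U, val w = x * r & pow_mul n i.+1 J w)).
- by exists 0; [rewrite mulr0 val0 | apply: ideal0].
- move=> a b [w ea na] [w' eb nb]; exists (w + w'); last exact: idealD.
  by rewrite valD ea eb mulrDr.
- move=> a b Ia /IH[w ew nw]; have [w' ew'] := kplus_lift Ia.
  exists (w' * w); first by rewrite valM ew ew' mulrCA.
  by apply: ideal_mulM => //; rewrite nE ew'.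
Qed.

(** The monomials [p^i q^j] with [i, j <= L] outnumber the dimension of the graded pieces that they
    can occupy, so they satisfy a linear relation over [k]; its lowest term is the relation
    sought. *)
Lemma gr_dim_le1 :
  (exists d, forall i, exists F : seq R,
    [/\ size F = d, forall f, f \in F -> ideal_pow I i f &
        forall r, ideal_pow I i r -> span_mod iota (ideal_pow I i.+1) F r]) ->
  dim_le1 (gr_ring n).
Proof.
move=> [d /choice[F FP]]; elim/gr_ind=> p; elim/gr_ind=> q.
have scalar_rees c : (kplus_scalar c)%:P \in rees_pred n (unit_ideal U).
  apply/rees_predP => -[|i] //; rewrite coefC.
  exact: (@ideal0 _ (pow_mul n i.+1 (unit_ideal U))).
pose krees c := Rees (scalar_rees c).
pose kap c : gr_ring n := gr_class (krees c).
have /choice[w wP] : forall ij : nat * nat, exists w : rees n (unit_ideal U),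
    rees_val w = rees_val p ^+ ij.1 * rees_val q ^+ ij.2 /\
    gr_class w = (gr_class p : gr_ring n) ^+ ij.1 * (gr_class q : gr_ring n) ^+ ij.2.
  case=> i j /=; elim: i => [|i [w [ew cw]]]; last first.
    exists (rees_mul p w); rewrite rees_valM ew -gr_mulE cw.
    by rewrite !exprS !mulrA.
  elim: j => [|j [w [ew cw]]].
    by exists (Rees (rees1_subproof n)); rewrite !expr0 !mulr1.
  exists (rees_mul q w); rewrite rees_valM ew -gr_mulE cw !expr0 !mul1r.
  by rewrite !exprS.
pose s := (size (rees_val p) + size (rees_val q))%N.
(* [D] bounds the size of all these monomials, and [D * d <= L * (L + 1) < (L + 1) ^ 2]. *)
pose L := (d * s.+1)%N; pose D := (s * L.+1).+1.
(* Coordinates of the degree-[l] coefficients in [I^l / I^(l+1)]; in degree 0 this views [U / n]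
   inside [R / I]. *)
have /choice[C CP] : forall ijl : nat * nat * nat, exists c : nat -> k,
    ideal_pow I ijl.2.+1 (val (rees_val (w ijl.1))`_ijl.2
      - \sum_(j < d) iota (c j) * (F ijl.2)`_j).
  case=> ij l; have [<- _ spF] := FP l.
  apply: (@span_mod_sum _ _ iota (ideal_pow I l.+1)); apply: spF.
  case: l => [//|l].
  exact: (proj1 (kplus_powP _ (isT : (0 < l.+1)%N)) (rees_coef (w ij) l.+1)).
have [|lam [[i0 j0] lam0] lamP] := @exists_linear_relation k
    ('I_L.+1 * 'I_L.+1)%type ('I_D * 'I_d)%type
    (fun ij lj => C (nat_of_ord ij.1, nat_of_ord ij.2, nat_of_ord lj.1) lj.2).
  by rewrite !card_prod !card_ord /D /L; nia.
have rel : \sum_(i < L.+1) (gr_class p : gr_ring n) ^+ i *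
    (\sum_(j < L.+1) kap (lam (inord i, inord j)) * (gr_class q : gr_ring n) ^+ j) = 0.
  pose z : rees n (unit_ideal U) :=
    \sum_ij rees_mul (krees (lam ij)) (w (nat_of_ord ij.1, nat_of_ord ij.2)).
  have -> : \sum_(i < L.+1) (gr_class p : gr_ring n) ^+ i *
    (\sum_(j < L.+1) kap (lam (inord i, inord j)) * (gr_class q : gr_ring n) ^+ j)
    = gr_class z.
    rewrite (big_morph _ (@gr_classD _ n (unit_ideal U)) (proj2 (gr_class_eq0 _) _)); last first.
      by move=> i; rewrite rees_val0 coef0; apply: ideal0.
    under [LHS]eq_bigr => i _ do rewrite mulr_sumr.
    rewrite pair_bigA /=; apply: eq_bigr => -[i j] _ /=.
    rewrite -gr_mulE; have [_ ->] := wP (nat_of_ord i, nat_of_ord j).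
    by rewrite !inord_val mulrCA.
  apply/gr_class_eq0 => l.
  rewrite (big_morph _ (@rees_valD _ n (unit_ideal U)) (@rees_val0 _ n (unit_ideal U))).
  rewrite coef_sum.
  have coefl ij : (rees_val (rees_mul (krees (lam ij)) (w (nat_of_ord ij.1, nat_of_ord ij.2))))`_l
      = kplus_scalar (lam ij) * (rees_val (w (nat_of_ord ij.1, nat_of_ord ij.2)))`_l.
    by rewrite rees_valM coefCM.
  under eq_bigr => ij _ do rewrite coefl.
  have [Dl|lD] := leqP D l.
    rewrite big1 => [|[i j] _ /=]; first exact: ideal0.
    have [-> _] := wP (nat_of_ord i, nat_of_ord j).
    rewrite nth_default ?mulr0 //=; apply: leq_trans Dl.
    have bound (f : {poly U}) (h : 'I_L.+1) : (size (f ^+ h) <= (size f * L.+1).+1)%N.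
      apply: leq_trans (size_poly_exp_leq _ _) _; rewrite ltnS.
      exact: leq_mul (leq_pred _) (ltnW (ltn_ord h)).
    have aux (a b c c' : nat) : (a <= c.+1 -> b <= c'.+1 -> (a + b).-1 <= (c + c').+1)%N by lia.
    rewrite /D /s mulnDl; apply: leq_trans (size_polyMleq _ _) _.
    exact: aux (bound _ _) (bound _ _).
  apply/(kplus_powP _ (isT : (0 < l.+1)%N)).
  rewrite (big_morph _ valD val0).
  pose c (ij : 'I_L.+1 * 'I_L.+1) := C (nat_of_ord ij.1, nat_of_ord ij.2, l) : nat -> k.
  (* By the choice of [lam] the subtracted combinations of [F l] cancel in the sum, so each term can
     be replaced by one in [I^(l+1)]. *)
  have -> : \sum_ij val (kplus_scalar (lam ij) *
       (rees_val (w (nat_of_ord ij.1, nat_of_ord ij.2)))`_l) =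
    \sum_(ij : 'I_L.+1 * 'I_L.+1) iota (lam ij) *
      (val (rees_val (w (nat_of_ord ij.1, nat_of_ord ij.2)))`_l
       - \sum_(j < d) iota (c ij j) * (F l)`_j).
    under [RHS]eq_bigr => ij _ do rewrite mulrBr.
    rewrite sumrB; under [X in _ = _ - X]eq_bigr => ij _ do rewrite mulr_sumr.
    rewrite [X in _ = _ - X]exchange_big [X in _ = _ - X]big1 ?subr0 => [|j _].
      by apply: eq_bigr => ij _; rewrite valM.
    under eq_bigr => ij _ do rewrite mulrA -rmorphM.
    rewrite -mulr_suml -rmorph_sum /=.
    by have := lamP (Ordinal lD, j); rewrite /c /= => ->; rewrite rmorph0 mul0r.
  apply: ideal_sum => ij _; apply: idealMl.
  exact: (CP (nat_of_ord ij.1, nat_of_ord ij.2, l)).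
have kap0 : kap 0 = 0.
  apply/gr_class_eq0 => i /=; have -> : kplus_scalar 0 = 0.
    by apply: val_inj; rewrite val0 /= rmorph0.
  by rewrite polyC0 coef0; apply: (@ideal0 _ (pow_mul n i.+1 (unit_ideal U))).
have kap1 : kap 1 = 1.
  congr gr_class; apply: val_inj => /=.
  have -> : kplus_scalar 1 = 1 by apply: val_inj; rewrite val1 /= rmorph1.
  by rewrite polyC1.
have kapM a b : kap (a * b) = kap a * kap b.
  rewrite /kap gr_mulE; congr gr_class; apply: val_inj => /=.
  rewrite -polyCM; congr (_%:P); apply: val_inj.
  by rewrite valM /= rmorphM.
have [|r [m [c [f [u]]]]] := lowest_term2 kap0 kap1 kapM (gr_class p : gr_ring n)
  (gr_class q : gr_ring n) (K := L.+1) (L := L.+1)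
  (g := fun i j => lam (inord i, inord j)).
  exists (nat_of_ord i0); first exact: ltn_ord.
  exists (nat_of_ord j0); first exact: ltn_ord.
  by rewrite !inord_val.
by rewrite rel mulr0 => e; exists r, m, c, f.
Qed.

Variable xU : U.
Hypothesis exU : val xU = x.

Lemma kplus_pow_mulx i (u : U) r : val u = x * r ->
  pow_mul n i J u <-> ideal_pow I i r.
Proof.
move=> e; rewrite kplus_pow_mulP e; split=> [[s Is /regx ->]//|Ir].
by exists r.
Qed.

Variables (t : rees n (unit_ideal U)) (e0 : rees n J).
Hypotheses (et : rees_val t = xU *: 'X^1) (ee0 : rees_val e0 = xU *: 'X^0).

Let T : gr_ring n := gr_class t.
Let e : gr_module n J := gr_class e0.

(** [T] raises degrees by one, so the coefficient in degree [i] is tested in degree [i + 1], whence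
    the exponent [i + 2]. *)
Lemma gr_T_scale (q : rees n J) :
  T *: gr_class q = 0 <-> forall i, pow_mul n i.+2 J (xU * (rees_val q)`_i).
Proof.
rewrite gr_scaleE gr_class_eq0 rees_valM et expr1 -scalerAl.
split=> h i; first by have := h i.+1; rewrite coefZ coefXM.
rewrite coefZ coefXM; case: i => [|i]; last exact: h.
by rewrite mulr0; apply: ideal0.
Qed.

(** Cancelling [x] from coefficients [x * r] turns one condition into the other; conversely, the
    monomial with coefficient [x * a] in degree [i] tests a given [a]. *)
Lemma gr_T_regular : initial_regular I x <-> forall v : gr_module n J, T *: v = 0 -> v = 0.
Proof.
split=> [xreg v|Treg i a Ia Ixa].
  elim/gr_ind: v => q /gr_T_scale h; apply/gr_class_eq0 => i.
  have /kplus_pow_mulP[r Ir er] := rees_coef q i.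
  apply/(kplus_pow_mulx _ er); apply: xreg => //.
  have er' : val (xU * (rees_val q)`_i) = x * (x * r) by rewrite valM exU er.
  exact: (proj1 (kplus_pow_mulx _ er') (h i)).
have [w ew] : exists w : U, val w = x * a.
  by apply: kplus_lift; rewrite mulrC; apply: idealMl.
have [q eq] := @exists_rees_monomial _ n J i w (proj2 (kplus_pow_mulx i ew) Ia).
have /Treg/gr_class_eq0/(_ i) : T *: gr_class q = 0.
  apply/gr_T_scale => j; rewrite eq coefZ coefXn.
  have [->|_] := eqVneq j i; last by rewrite !mulr0; apply: ideal0.
  have ew' : val (xU * w) = x * (x * a) by rewrite valM exU ew.
  by rewrite mulr1; apply/(kplus_pow_mulx _ ew').
by rewrite eq coefZ coefXn eqxx mulr1 => /(kplus_pow_mulx _ ew).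
Qed.

Lemma gr_T_plus : gr_plus n T.
Proof. by apply/gr_plus_class; rewrite et coefZ coefXn mulr0; apply: ideal0. Qed.

(** In degree 0, [T *: w] has no component, while that of [s *: e] is [x] times an element outside
    [I], hence is not in [n J = x I]. *)
Lemma gr_e_notin (s : gr_ring n) (w : gr_module n J) :
  ~ gr_plus n s -> s *: e <> T *: w.
Proof.
elim/gr_ind: s => p; elim/gr_ind: w => q np.
rewrite !gr_scaleE => /gr_classP/rees_shiftP/(_ 0%N).
rewrite rees_valB !rees_valM coefB !coef0M et ee0 !coefZ !coefXn mulr0 mul0r subr0 mulr1.
move=> /(@kplus_pow_mulx 1 _ (val (rees_val p)`_0)).
rewrite valM exU mulrC => /(_ erefl)/ideal_pow1 h.
by apply: np; apply/gr_plus_class.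
Qed.

(** [s] can be cancelled, and [T ^+ j *: e] is the class of [x ^+ j.+1] in degree [j], zero only if
    [x ^+ j] is in [I^(j+1)]. *)
Lemma gr_T_exp_scale (s : gr_ring n) j :
  (forall j, ~ ideal_pow I j.+1 (x ^+ j)) -> ~ gr_plus n s -> (s * T ^+ j) *: e <> 0.
Proof.
move=> xj ns; rewrite -scalerA => /(gr_plus_regular kplus_max ns).
have -> : T ^+ j *: e = gr_class (iter j (rees_mul t) e0).
  elim: j => [|j IH]; first by rewrite scale1r.
  by rewrite exprS -scalerA IH gr_scaleE.
have val_iter i : rees_val (iter i (rees_mul t) e0) = (xU ^+ i.+1) *: 'X^i.
  elim: i => [|i IH]; first by rewrite /= ee0.
  by rewrite /= IH et -scalerAl -scalerAr scalerA -exprS -exprS.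
move=> /gr_class_eq0/(_ j); rewrite val_iter coefZ coefXn eqxx mulr1.
by move=> /(@kplus_pow_mulx j.+1 _ (x ^+ j)); rewrite valX exU exprS => /(_ erefl)/xj.
Qed.

(** In degree [i > 0] a coefficient of the product is [x * r] with [r] in [I^i = n^i], so [r] is in
    [U]; in degree 0 it vanishes once [s] is represented without constant term. *)
Lemma gr_plus_scale_cyclic (s : gr_ring n) (v : gr_module n J) : gr_plus n s ->
  exists a : gr_ring n, s *: v = a *: e.
Proof.
elim/gr_ind: v => q /(gr_plus_exp 1)[p []]; rewrite expr1 => <- p0; rewrite gr_scaleE.
have /choice[w wP] : forall i, exists w : U,
    pow_mul n i (unit_ideal U) w /\ (rees_val p * rees_val q)`_i = xU * w.
  case=> [|i].
    by exists 0; rewrite mulr0 coef0M p0 // mul0r.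
  have /kplus_pow_mulP[r Ir er] := rees_coef (rees_mul p q) i.+1.
  have [w ew] := kplus_lift (proj1 (ideal_pow1 _ _) (@ideal_pow_le _ _ 1 i.+1 _ isT Ir)).
  exists w; split; first by apply/(kplus_powP w (isT : (0 < i.+1)%N)); rewrite ew.
  by apply: val_inj; rewrite valM exU ew.
have hw : \poly_(i < size (rees_val p * rees_val q)) w i \in rees_pred n (unit_ideal U).
  apply/rees_predP => i; rewrite coef_poly; case: ifP => _; last exact: ideal0.
  by have [] := wP i.
exists (gr_class (Rees hw)); rewrite gr_scaleE; congr gr_class; apply: val_inj => /=.
apply/polyP => i; rewrite ee0 expr0 -scalerAr mulr1 coefZ coef_poly.
case: ltnP => [_|/(nth_default 0) ->]; last by rewrite mulr0.
by have [_ ->] := wP i.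
Qed.

(** A high power of [a] lives in degrees where [n^(j+1) = x n^j], so each of its coefficients
    contains a factor [x], which acts as [T]. *)
Lemma gr_plus_exp_T : principal_reduction x I ->
  exists d, forall (a : gr_ring n) (v : gr_module n J),
    gr_plus n a -> T *: v = 0 -> a ^+ d *: v = 0.
Proof.
(* [N + 2] makes [j] positive below even if [N = 0], so that the quotient by [x] lies in [I^j],
   inside [U]. *)
case=> _ [N red]; exists N.+2 => a v /(gr_plus_exp N.+2)[p [<- p0]].
elim/gr_ind: v => q /gr_T_scale h; rewrite gr_scaleE; apply/gr_class_eq0 => i.
rewrite rees_valM coefM; apply: (@ideal_sum _ _ (pow_mul n i.+1 J)) => j' _.
move: (nat_of_ord j') (ltn_ord j') => j ji {j'}.
have [jN|Nj] := ltnP j N.+2; first by rewrite p0 // mul0r; apply: ideal0.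
case: j ji Nj => [//|j] ji Nj.
have /(kplus_powP _ (isT : (0 < j.+1)%N)) := rees_coef p j.+1.
move=> /(reduction_step Ix red (ltnW Nj))[r Ir er].
have j_gt0 : (0 < j)%N by lia.
have [w ew] := kplus_lift (proj1 (ideal_pow1 _ _) (@ideal_pow_le _ _ 1 j _ j_gt0 Ir)).
have -> : (rees_val p)`_j.+1 = w * xU.
  by apply: val_inj; rewrite valM ew exU mulrC.
rewrite -mulrA; apply: (@pow_mulM _ _ _ j (i - j.+1).+2 _ _ _ _ _ (h _)); first by lia.
by apply/(kplus_powP w j_gt0); rewrite ew.
Qed.

End FiberRing.

(** * The Cohen-Macaulay property *)

Section CohenMacaulay.
Variables (k : fieldType) (R : comNzRingType) (iota : {rmorphism k -> R}).
Variables (I : ideal R) (x : R).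
Hypotheses (properI : ~ I 1) (regx : GRing.lreg x) (redx : principal_reduction x I).

Let U := kplus iota I.
Let n : ideal U := kplus_ideal iota I I.
Let J : ideal U := kplus_ideal iota I (principal_ideal x).

Lemma initial_forms : exists xU : U, val xU = x /\
  (exists t : rees n (unit_ideal U), rees_val t = xU *: 'X^1) /\
  (exists e : rees n J, rees_val e = xU *: 'X^0).
Proof.
have [Ix _] := redx; have [xU exU] := kplus_lift iota Ix.
exists xU; split=> //; split.
  by apply: exists_rees_monomial; apply/ideal_pow1; rewrite -exU in Ix.
by apply: exists_rees_monomial; exists 1; rewrite mulr1.
Qed.

Lemma cm_of_initial_regular : dim_le1 (gr_ring n) -> initial_regular I x ->
  @cohen_macaulay (gr_ring n) (gr_module n J).
Proof.
have [Ix _] := redx; have [xU [exU [[t et] [e0 ee0]]]] := initial_forms.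
move=> K /(gr_T_regular Ix regx exU et) Treg P Pmax [v0 v0nz].
have nmax := kplus_max iota properI.
set T : gr_ring n := gr_class t in Treg; set e : gr_module n J := gr_class e0.
have loc_reg (a : gr_ring n) : (forall v : gr_module n J, a *: v = 0 -> v = 0) ->
    forall v : loc_module P (gr_module n J),
      (frac (a : (gr_ring n)^o) (den1 P) : loc_ring P) *: v = 0 -> v = 0.
  move=> areg; elim/frac_ind => v s; rewrite frac_scaleE => /frac_eq0[u hu].
  apply/frac_eq0; exists u; apply: areg.
  by rewrite scalerA mulrC -scalerA.
have e_frac (a : gr_ring n) (w : loc_module P (gr_module n J)) :
    frac e (den1 P) = (frac (a : (gr_ring n)^o) (den1 P) : loc_ring P) *: w ->
    exists s w', ~ P s /\ s *: e = a *: w'.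
  elim/frac_ind: w => w s; rewrite frac_scaleE => /fracP[u].
  rewrite den1E denME den1E mul1r mulr1 => h.
  exists (den u * den s), (den u *: w); split.
    by apply: prime_notM; apply: denP.
  by rewrite h !scalerA mulrC.
(* If [P] contains [gr_plus], then [T] is the regular element. *)
have [sub|nsub] := EM (forall a, gr_plus n a -> P a).
  apply: (@cm_local_dim1 _ P (loc_module P (gr_module n J))
    (frac (T : (gr_ring n)^o) (den1 P)) (frac e (den1 P)) K) => //.
  - by apply/loc_max_frac; apply: sub; apply: gr_T_plus et.
  - exact: loc_reg.
  - move=> w /e_frac[s [w' [ns]]]; apply: (gr_e_notin Ix regx exU et ee0).
    by move=> /sub.
have [s [sp nPs]] : exists s, gr_plus n s /\ ~ P s.
  apply: contrapT => h; apply: nsub => a ap; apply: contrapT => na.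
  by apply: h; exists a.
(* Otherwise [1 - c * s] is in [P] but outside [gr_plus], hence regular. *)
have [c Pc] := maximal_inverse Pmax nPs.
apply: (@cm_local_dim1 _ P (loc_module P (gr_module n J))
  (frac ((1 - c * s) : (gr_ring n)^o) (den1 P)) (frac e (den1 P)) K) => //.
- by apply/loc_max_frac.
- apply: loc_reg => v; apply: (gr_plus_regular nmax) => h.
  apply: (gr_plus1 nmax); rewrite -[1](subrK (c * s)).
  by apply: idealD => //; apply: idealMl.
(* [s] is a unit at [P] and [s *: M] lies in the submodule generated by [e], so
   the localization at [P] is cyclic, generated by [e]. *)
- move=> w /e_frac[s1 [w1 [ns1 h1]]]; move/eqP: v0nz; apply.
  have [a ha] := gr_plus_scale_cyclic Ix exU ee0 w1 sp.
  (* Multiplying by [s] turns [w1] into a multiple of [e]. The resulting annihilator of [e] is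
     outside [P], since [s * s1] is and [1 - c * s] is in [P]. *)
  have {}h1 : (s * s1 - (1 - c * s) * a) *: e = 0.
    by rewrite scalerBl -!scalerA h1 -ha !scalerA [s * _]mulrC subrr.
  have ns2 : ~ P (s * s1 - (1 - c * s) * a).
    move=> h; apply: (prime_notM nPs ns1); rewrite -[s * s1](subrK ((1 - c * s) * a)).
    by apply: idealD => //; rewrite mulrC; apply: idealMl.
  elim/frac_ind: v0 => v s2; apply/frac_eq0.
  have [b hb] := gr_plus_scale_cyclic Ix exU ee0 v sp.
  exists (denM (mkden ns2) (mkden nPs)); rewrite denME -scalerA hb scalerA mulrC.
  by rewrite -scalerA h1 scaler0.
Qed.

(** Localize at [gr_plus]. No [s * T ^+ j] with [s] outside kills [e], so the dimension, and with it
    the depth, is positive. A regular element has a power killing whatever [T] kills, which is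
    therefore zero. *)
Lemma initial_regular_of_cm : (forall j, ~ ideal_pow I j.+1 (x ^+ j)) ->
  @cohen_macaulay (gr_ring n) (gr_module n J) -> initial_regular I x.
Proof.
move=> xj; have [Ix _] := redx.
have [xU [exU [[t et] [e0 ee0]]]] := initial_forms.
have nmax := kplus_max iota properI.
have pmax := gr_plus_maximal nmax.
pose P := PrimeIdeal (maximal_prime pmax).
set M := gr_module n J; pose T : gr_ring n := gr_class t; pose e : M := gr_class e0.
have noT s j : ~ P s -> (s * T ^+ j) *: e <> 0.
  exact: (gr_T_exp_scale properI Ix regx exU et ee0 xj).
move=> /(_ P pmax)[|d [[s sd [[reg _] sm]] _] [_ dimM]].
  exists (frac e (den1 P)); apply/eqP => /frac_eq0[u].
  by have := noT (den u) 0%N (denP (s := u)); rewrite mulr1.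
have Tmax : loc_maxI P (frac (T : (gr_ring n)^o) (den1 P)).
  by apply/loc_max_frac; apply: gr_T_plus et.
have [|Q /dimM d_gt0] := @loc_prime_chain _ P (loc_module P M) _ Tmax.
  move=> u j nu /(_ (frac e (den1 P))).
  have [sj ->] : exists sj, (frac (T : (gr_ring n)^o) (den1 P) : loc_ring P) ^+ j =
      frac (T ^+ j : (gr_ring n)^o) sj.
    elim: j => [|j [sj IH]]; first by exists (den1 P).
    by exists (denM (den1 P) sj); rewrite exprS IH frac_mul -exprS.
  elim/frac_ind: u nu => a s' nu; rewrite frac_mul frac_scaleE => /frac_eq0[u'].
  rewrite scalerA mulrA; apply: noT; apply: prime_notM; first exact: denP.
  by move=> Pa; apply: nu; apply/loc_max_frac.
case: s sd reg sm => [/eqP|s0 s _ reg sm]; first by rewrite eq_sym eqn0Ngt d_gt0.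
have [q hq] := gr_plus_exp_T Ix exU et redx.
apply/(gr_T_regular Ix regx exU et) => v Tv.
have s0reg l (w : loc_module P M) : s0 ^+ l *: w = 0 -> w = 0.
  elim: l => [|l IH]; first by rewrite scale1r.
  rewrite exprS -scalerA => h; apply: IH.
  have [|w'] := reg 0%N isT (s0 ^+ l *: w); last by rewrite big_ord0.
  by exists (fun=> 0); rewrite big_ord0.
have ms0 : loc_maxI P s0 by apply: sm; rewrite mem_head.
(* Vanishing in the localization suffices, as elements outside [gr_plus] are regular on [M]. *)
suff /frac_eq0[u /(gr_plus_regular nmax)] : frac v (den1 P) = 0 :> loc_module P M.
  by apply; apply: (denP (s := u)).
apply: (s0reg q); move: ms0; elim/frac_ind: s0 {reg sm s0reg} => a s0 /loc_max_frac Pa.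
have [sq ->] : exists sq, (frac (a : (gr_ring n)^o) s0 : loc_ring P) ^+ q =
    frac (a ^+ q : (gr_ring n)^o) sq.
  elim: (q) => [|l [sl IH]]; first by exists (den1 P).
  by exists (denM s0 sl); rewrite exprS IH frac_mul -exprS.
rewrite frac_scaleE; apply/frac_eq0; exists (den1 P).
by rewrite hq // scaler0.
Qed.

End CohenMacaulay.

Theorem corollary3p3 (R : comNzRingType) (m : ideal R)
    (k : fieldType) (iota : {rmorphism k -> R}) (I : ideal R) (x : R) :
  is_local m -> noetherian R -> has_dim R^o 1 -> cm_local R^o m ->
  coefficient_field iota m -> infinite_set [set: k] ->
  ~ I 1 -> regular_ideal I -> principal_reduction x I ->
  let n := kplus_ideal iota I I in
  let J := kplus_ideal iota I (principal_ideal x) in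
  asymptotic_rr_number I = 1%N <->
  @cohen_macaulay (gr_ring n) (gr_module n J).
Proof.
move=> locm noeth dim1 _ coef _ properI regI redx n J.
have [Ix _] := redx; have regx := reduction_regular regI redx.
rewrite asymptotic_rr_number1 (rr_closed_initial_regular Ix redx); split.
  apply: cm_of_initial_regular => //; apply: gr_dim_le1 => //.
  exact: (bounded_dims locm noeth dim1 regI redx coef).
apply: initial_regular_of_cm => // j.
exact: (reduction_pow_notin locm noeth properI regI redx).
Qed.
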